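(* Let $K\subset\mathbb{R}^n$ be a generalized Orlicz ball, let $(a_i)_{i=1}^n$ be any sequence of reals, and let $X_1,\dots,X_n$ be the coordinates of a random vector uniformly distributed on $K$. Let $X_1^\star,\dots,X_n^\star$ be independent random variables such that, for each $i$, $X_i^\star$ has the same distribution as $X_i$. Then for any convex function $f:\mathbb{R}\to\mathbb{R}$, $$\mathbb{E} f\Big(\sum_{i=1}^n|a_iX_i|\Big)\le \mathbb{E} f\Big(\sum_{i=1}^n|a_iX_i^\star|\Big).$$ If additionally $f$ is increasing, then for any sequence of reals $(c_i)_{i=1}^n$, $$\mathbb{E} f\Big(\max_{k=1,\dots,n}\sum_{i=1}^k\big(|a_iX_i|-c_i\big)\Big)\le \mathbb{E} f\Big(\max_{k=1,\dots,n}\sum_{i=1}^k\big(|a_iX_i^\star|-c_i\big)\Big).$$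
   Context: A function $f:[0,\infty)\to[0,\infty]$ is a Young function if it is convex, $f(0)=0$, $f(x)\neq 0$ for some $x$, and $f(x)\neq\infty$ for some $x\neq 0$. Given $n$ Young functions $f_1,\dots,f_n$, the set $K=\{(x_1,\dots,x_n)\in\mathbb{R}^n:\sum_{i=1}^n f_i(|x_i|)\le 1\}$ is called a generalized Orlicz ball. Uniform distribution on $K$ means normalized Lebesgue measure on $K$. ''Increasing'' means weakly increasing. *)

(* Defs.v *)
From HB Require Import structures.
From mathcomp Require Import all_boot all_order all_algebra.
From mathcomp Require Import all_classical all_reals all_analysis.

Set Implicit Arguments.
Unset Strict Implicit.
Unset Printing Implicit Defensive.

Import Order.TTheory GRing.Theory Num.Theory.
Import numFieldNormedType.Exports.

Local Open Scope classical_set_scope.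
Local Open Scope ring_scope.

(* A Young function [0, +oo) -> [0, +oo] is represented by f : R -> \bar R; the
   values of f on negative reals are unconstrained and never used. Convexity
   relies on the convention 0 * +oo = 0 of \bar R. *)
Record young_function (R : realType) (f : R -> \bar R) : Prop := YoungFunction {
  young_ge0 : forall x : R, 0 <= x -> (0 <= f x)%E ;
  young_convex : forall x y t : R, 0 <= x -> 0 <= y -> 0 <= t <= 1 ->
    (f (t * x + (1 - t) * y)%R <= t%:E * f x + (1 - t)%:E * f y)%E ;
  young0 : f 0 = 0%E ;
  young_neq0 : exists2 x : R, 0 <= x & f x <> 0%E ;
  young_neqy : exists2 x : R, 0 < x & f x <> +oo%E }.

Definition orlicz_ball (R : realType) n (f : 'I_n -> R -> \bar R) :
    set (n.-tuple R) :=
  [set x | (\sum_(i < n) f i (`|tnth x i|)%R <= 1)%E].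

Section lebesgue_tuple.
Context {R : realType}.

Definition tuple_cons n (p : measurableTypeR R * n.-tuple R) : n.+1.-tuple R :=
  [tuple of p.1 :: p.2].

Lemma measurable_tuple_cons n : measurable_fun setT (@tuple_cons n).
Proof. exact: measurable_cons. Qed.

HB.instance Definition _ n :=
  isMeasurableFun.Build _ _ _ _ (@tuple_cons n) (@measurable_tuple_cons n).

(* Lebesgue measure on R^n, as an iterated product. *)
Fixpoint lebesgue_tuple n : set (n.-tuple R) -> \bar R :=
  if n is n'.+1 then
    pushforward (lebesgue_measure \x @lebesgue_tuple n')%E (@tuple_cons n')
  else \d_([tuple] : 0.-tuple R).

Definition tuple_uncons n (t : n.+1.-tuple R) : measurableTypeR R * n.-tuple R :=
  (thead t, [tuple of behead t]).

Lemma tuple_consK n : cancel (@tuple_cons n) (@tuple_uncons n).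
Proof.
move=> [x t]; rewrite /tuple_cons /tuple_uncons /= theadE; congr pair.
exact: val_inj.
Qed.

Lemma measurable_tuple_uncons n : measurable_fun setT (@tuple_uncons n).
Proof.
apply/measurable_fun_pair; first exact: measurable_tnth.
exact: measurable_behead.
Qed.

Lemma sigma_finite_measure_of d (T : measurableType d) (mu : set T -> \bar R) :
  mu set0 = 0%E -> (forall A, (0 <= mu A)%E) -> semi_sigma_additive mu ->
  sigma_finite setT mu ->
  {m : {sigma_finite_measure set T -> \bar R} | mu = m}.
Proof.
move=> mu0 mu_ge0 mu_sa sf.
pose M := isMeasure.Build _ _ _ mu mu0 mu_ge0 mu_sa.
pose mm : {measure set T -> \bar R} := HB.pack mu M.
pose S := Measure_isSigmaFinite.Build _ _ _ mm sf.
pose m' : {sigma_finite_measure set T -> \bar R} := HB.pack mu M S.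
by exists m'.
Qed.

Lemma lebesgue_tuple_sigma_finite_measure n :
  {m : {sigma_finite_measure set (n.-tuple R) -> \bar R} |
    @lebesgue_tuple n = m}.
Proof.
elim: n => [|n [m mE]] /=; first by exists (\d_([tuple] : 0.-tuple R)).
rewrite mE.
pose prod : {measure set (measurableTypeR R * n.-tuple R)%type -> \bar R} :=
  (@lebesgue_measure R \x m)%E.
pose mu := pushforward prod (@tuple_cons n).
have sf : sigma_finite setT mu.
  have /sigma_finiteP[F [TF ndF Foo]] := sigma_finiteT (@lebesgue_measure R).
  have /sigma_finiteP[G [TG ndG Goo]] := sigma_finiteT m.
  exists (fun k => @tuple_uncons n @^-1` (F k `*` G k)).
    rewrite -preimage_bigcup (_ : \bigcup_k _ = setT) ?preimage_setT//.
    rewrite -setXTT TF TG; apply/seteqP; split => -[x y] /=.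
      by move=> [k _ [/= ? ?]]; split; exists k.
    move=> [[j _ Fx] [k _ Gy]]; exists (maxn j k) => //; split => /=.
      by move: x Fx; exact/subsetPset/ndF/leq_maxl.
    by move: y Gy; exact/subsetPset/ndG/leq_maxr.
  move=> k; have [mF ?] := Foo k; have [mG ?] := Goo k; split.
    rewrite -[X in measurable X]setTI; apply: measurable_tuple_uncons => //.
    exact: measurableX.
  rewrite /mu /pushforward -comp_preimage (_ : _ \o _ = id); last first.
    by apply/funext => p; exact: tuple_consK.
  by rewrite /prod /= product_measure1E// lte_mul_pinfty// ge0_fin_numE.
have mu0 : mu set0 = 0%E by rewrite /mu /pushforward preimage_set0 measure0.
have mu_ge0 A : (0 <= mu A)%E by exact: measure_ge0.
have mu_sa : semi_sigma_additive mu.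
  move=> F mF tF mUF; rewrite /mu /pushforward preimage_bigcup.
  have mpre A : measurable A -> measurable (@tuple_cons n @^-1` A).
    by move=> mA; rewrite -[X in measurable X]setTI;
      exact: measurable_tuple_cons.
  apply: measure_semi_sigma_additive => [k||]; first exact: mpre.
    apply/trivIsetP => /= i j _ _ ij; rewrite -preimage_setI.
    by move/trivIsetP : tF => /(_ _ _ _ _ ij) ->//; rewrite preimage_set0.
  by rewrite -preimage_bigcup; exact: mpre.
exact: sigma_finite_measure_of.
Qed.

Section lebesgue_tuple_measure.
Variable n : nat.

Let lebesgue_tuple0 : @lebesgue_tuple n set0 = 0%E.
Proof.
by have [m ->] := lebesgue_tuple_sigma_finite_measure n; exact: measure0.
Qed.

Let lebesgue_tuple_ge0 A : (0 <= @lebesgue_tuple n A)%E.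
Proof.
by have [m ->] := lebesgue_tuple_sigma_finite_measure n; exact: measure_ge0.
Qed.

Let lebesgue_tuple_sigma_additive : semi_sigma_additive (@lebesgue_tuple n).
Proof.
have [m ->] := lebesgue_tuple_sigma_finite_measure n.
exact: measure_semi_sigma_additive.
Qed.

HB.instance Definition _ := isMeasure.Build _ _ _ (@lebesgue_tuple n)
  lebesgue_tuple0 lebesgue_tuple_ge0 lebesgue_tuple_sigma_additive.

Let lebesgue_tuple_sigma_finite : sigma_finite setT (@lebesgue_tuple n).
Proof.
by have [m ->] := lebesgue_tuple_sigma_finite_measure n; exact: sigma_finiteT.
Qed.

HB.instance Definition _ := Measure_isSigmaFinite.Build _ _ _
  (@lebesgue_tuple n) lebesgue_tuple_sigma_finite.

End lebesgue_tuple_measure.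

Lemma lebesgue_tuple_box n (A : 'I_n -> set R) :
  (forall i, measurable (A i)) ->
  lebesgue_tuple [set x : n.-tuple R | forall i, A i (tnth x i)] =
  (\prod_(i < n) lebesgue_measure (A i))%E.
Proof.
elim: n A => [|n IHn] A mA.
  rewrite /= big_ord0 diracE mem_set//; by case.
rewrite big_ord_recl -IHn//.
rewrite -product_measure1E; [|exact: mA|]; last first.
  rewrite (_ : [set _ | _] = \bigcap_(i in setT)
    ((@tnth n R ^~ i) @^-1` A (lift ord0 i))).
    apply: fin_bigcap_measurable => [|i _]; first exact: finite_finset.
    by rewrite -[X in measurable X]setTI; exact: measurable_tnth.
  by apply/seteqP; split => x /= H i; [move=> _; exact: H|exact: (H i I)].
rewrite /= /pushforward; congr (product_measure1 _ _ _).
have tcS x (t : n.-tuple R) i :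
  tnth (tuple_cons (x, t)) (lift ord0 i) = tnth t i by rewrite tnthS.
apply/seteqP; split => -[x t] /= H.
  split; first exact: (H ord0).
  by move=> i; have := H (lift ord0 i); rewrite tcS.
move=> i; case: H => Hx Ht.
by case: (unliftP ord0 i) => [j|] -> //; rewrite tcS; exact: Ht.
Qed.

End lebesgue_tuple.

Definition uniform_on d d' (T : measurableType d) (T' : measurableType d')
    (R : realType) (mu : set T' -> \bar R) (K : set T')
    (P : probability T R) (X : {RV P >-> T'}) : Prop :=
  forall A, measurable A -> distribution P X A = (mu (A `&` K) / mu K)%E.

Definition mutually_independent d d' (T : measurableType d)
    (T' : measurableType d') (R : realType) (P : probability T R)
    (I : finType) (Y : I -> {RV P >-> T'}) : Prop :=
  forall (J : {set I}) (A : I -> set T'), (forall i, measurable (A i)) ->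
    P (\bigcap_(i in [set` J]) (Y i @^-1` A i)) =
    (\prod_(i in J) P (Y i @^-1` A i))%E.

Section coordinate.
Context d (T : measurableType d) (R : realType) (P : probability T R) (n : nat).

Definition rv_coord (X : {RV P >-> n.-tuple R}) (i : 'I_n) : T -> R :=
  fun w => tnth (X w) i.

Lemma measurable_rv_coord X i : measurable_fun setT (rv_coord X i).
Proof. by apply: (measurableT_comp (measurable_tnth i)). Qed.

HB.instance Definition _ X i :=
  isMeasurableFun.Build _ _ _ _ (rv_coord X i) (@measurable_rv_coord X i).

End coordinate.

Definition same_distribution d1 d2 d' (T1 : measurableType d1)
    (T2 : measurableType d2) (T' : measurableType d') (R : realType)
    (P : probability T1 R) (Q : probability T2 R)
    (X : {RV P >-> T'}) (Y : {RV Q >-> T'}) : Prop :=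
  forall A, measurable A -> distribution P X A = distribution Q Y A.

Definition max_partial_sum (R : realType) n (x : 'I_n.+1 -> R) : R :=
  let s (k : 'I_n.+1) := \sum_(i < n.+1 | (i <= k)%N) x i in
  \big[Num.max/s ord0]_(k < n.+1) s k.

(* Main.v *)
(* Given X_1 = s, the other coordinates are uniform on the ball {sum_(i > 1) f_i(|x_i|) <= 1 - f_1(|s|)}, so everything reduces to the
   claim that the law of the remaining coordinates increases stochastically with the level
   of the ball: then |X_1| is negatively associated with increasing functions of the
   others, symmetrisation shows that replacing X_1 by an independent copy increases the
   mean of every supermodular function, and one iterates.  Both functionals of the theorem
   are supermodular in the |x_i|.  To make the iteration close up, the uniform law is
   replaced by the density V(r - sum_i f_i(|x_i|)) with V nondecreasing, zero on the
   negatives and log-concave; integrating out one coordinate gives a density of the same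
   form.

   The claim is proved by induction on the dimension, through a quantile coupling of the laws of
   one coordinate x at two levels r <= r'.  Along it x increases, because V is
   log-concave, and so does the slack r - f(|x|), because f is convex: translation
   by y - x maps the tail beyond x into the tail beyond y when f(x) + r' - r <= f(y).
   Monotonicity of the slack also yields log-concavity of the marginal weight, so the
   Brunn-Minkowski inequality is not needed. *)

Require Import Defs.
From HB Require Import structures.
From mathcomp Require Import all_boot all_order all_algebra.
From mathcomp Require Import all_classical all_reals all_analysis.
From mathcomp Require Import measurable_realfun ring lra.

Set Implicit Arguments.
Unset Strict Implicit.
Unset Printing Implicit Defensive.

Import Order.TTheory GRing.Theory Num.Theory.
Import numFieldNormedType.Exports.

Local Open Scope classical_set_scope.
Local Open Scope ring_scope.

(** * Densities, transport and the quantile transform *)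

Import HBNNSimple.

Section generic_integrals.
Context d (T : measurableType d) (R : realType).
Implicit Types (mu nu : {measure set T -> \bar R}) (w H : T -> R).
Local Open Scope ereal_scope.

(** The obstacle in the coupling is that a Young function may jump at the right end of its domain,
    and at this point the slack can drop. The coordinate has a density, so the point is null, and
    the functional at the upper level may be altered there at no cost. Two eliminations coexist for
    a weight [V] and [f = phi ord0]. Integrating out all coordinates but the first leaves the weight
    [total_mass V phi'], which governs the first coordinate; integrating out the first leaves
    [mass V f], which governs the others. Fubini identifies their normalising constants. Decoupling
    rests on one symmetrised inequality. Let [p x] be the density of the first coordinate and
    [q x y] the integral of [g (x, .)] against the others when their level is the one left by [y].
    For [|x| <= |y|] the claim is [p x * (q y y - q x y) <= p y * (q y x - q x x)]: supermodularity
    makes [g (y, .) - g (x, .)] nondecreasing, and its mean is smaller at the lower level left by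
    [y]. All means are compared after cross-multiplication, because the weights may vanish. *)

Lemma le_ge0_integral mu H1 H2 : (forall x, 0 <= H1 x)%R ->
  measurable_fun setT H1 -> measurable_fun setT H2 ->
  (forall x, H1 x <= H2 x)%R ->
  \int[mu]_x (H1 x)%:E <= \int[mu]_x (H2 x)%:E.
Proof.
move=> H0 m1 m2 le; apply: ge0_le_integral => //.
- by move=> x _; rewrite lee_fin.
- exact/measurable_EFinP.
- exact/measurable_EFinP.
- by move=> x _; rewrite lee_fin.
Qed.

Lemma ge0_integralZ mu (k : R) H : (0 <= k)%R -> (forall x, 0 <= H x)%R ->
  measurable_fun setT H ->
  \int[mu]_x (k * H x)%:E = k%:E * \int[mu]_x (H x)%:E.
Proof.
move=> k0 H0 mH; under eq_integral do rewrite EFinM.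
by rewrite ge0_integralZl//; [exact/measurable_EFinP|move=> x _; rewrite lee_fin].
Qed.

Lemma ge0_integral_add mu H1 H2 : (forall x, 0 <= H1 x)%R ->
  (forall x, 0 <= H2 x)%R -> measurable_fun setT H1 -> measurable_fun setT H2 ->
  \int[mu]_x (H1 x + H2 x)%:E = \int[mu]_x (H1 x)%:E + \int[mu]_x (H2 x)%:E.
Proof.
move=> H10 H20 m1 m2; under eq_integral do rewrite EFinD.
rewrite ge0_integralD//.
- by move=> x _; rewrite lee_fin.
- exact/measurable_EFinP.
- by move=> x _; rewrite lee_fin.
- exact/measurable_EFinP.
Qed.

(** The hypothesis is the case of indicators; linearity gives nonnegative simple functions and
    monotone convergence from below gives the rest. *)
Lemma integral_density mu nu w : (forall x, 0 <= w x)%R ->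
  measurable_fun setT w ->
  (forall A, measurable A -> nu A = \int[mu]_x (\1_A x * w x)%:E) ->
  forall H, (forall x, 0 <= H x)%R -> measurable_fun setT H ->
  \int[nu]_x (H x)%:E = \int[mu]_x (H x * w x)%:E.
Proof.
move=> w0 mw nuE H H0 mH.
have mEH : measurable_fun setT (EFin \o H) by exact/measurable_EFinP.
pose h := nnsfun_approx measurableT mEH.
have HE x : (EFin \o H) x = limn (fun n => (h n x)%:E).
  by apply/esym/cvg_lim => //; apply: (cvg_nnsfun_approx measurableT mEH) => // y _; rewrite lee_fin.
have ndh x : {homo (fun n => (h n x)) : n m / (n <= m)%N >-> (n <= m)%R}.
  by move=> n m nm; exact: (lefP _ _ (nd_nnsfun_approx measurableT mEH nm)).
transitivity (limn (fun n => \int[nu]_x (h n x)%:E)).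
  under eq_integral => x _ do rewrite (HE x : (H x)%:E = _).
  rewrite monotone_convergence//.
  - by move=> n; exact/measurable_EFinP.
  - by move=> n x _; rewrite lee_fin.
  - by move=> x _ n m nm; rewrite lee_fin ndh.
have HwE x : (H x * w x)%:E = limn (fun n => (h n x * w x)%:E).
  apply/esym/cvg_lim => //; rewrite EFinM.
  under eq_fun do rewrite EFinM.
  apply: cvgeZr => //.
  by apply: (cvg_nnsfun_approx measurableT mEH) => // y _; rewrite lee_fin.
transitivity (limn (fun n => \int[mu]_x (h n x * w x)%:E)); last first.
  under [RHS]eq_integral => x _ do rewrite HwE.
  rewrite monotone_convergence//.
  - by move=> n; apply/measurable_EFinP/measurable_funM.
  - by move=> n x _; rewrite lee_fin mulr_ge0.
  - by move=> x _ n m nm; rewrite lee_fin ler_wpM2r// ndh.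
congr (limn _); apply/funext => n.
have m1 y : measurable_fun setT (fun x => (y * \1_(h n @^-1` [set y]) x)%R).
  by apply: measurable_funM.
have ge0 y x : 0 <= (y * \1_(h n @^-1` [set y]) x)%:E.
  exact: nnfun_muleindic_ge0.
transitivity (\int[nu]_x (\sum_(y \in range (h n)) (y * \1_(h n @^-1` [set y]) x)%:E)).
  by apply: eq_integral => t tE; rewrite /= [in LHS]fimfunE -fsumEFin.
rewrite ge0_integral_fsum//; last by move=> y; exact/measurable_EFinP.
transitivity (\int[mu]_x (\sum_(y \in range (h n))
    ((y * \1_(h n @^-1` [set y]) x)%:E * (w x)%:E))); last first.
  apply: eq_integral => x xE.
  rewrite -ge0_mule_fsuml => [|y]; last exact: ge0.
  by rewrite fsumEFin// -(fimfunE _ x) EFinM.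
rewrite ge0_integral_fsum//; last 2 first.
- by move=> y; apply: emeasurable_funM; exact/measurable_EFinP.
- by move=> y x _; rewrite mule_ge0// lee_fin.
apply: eq_fsbigr => y yh.
have [k0|k0] := leP 0%R y; last first.
  have -> : h n @^-1` [set y] = set0.
    rewrite -subset0 => x /= hxy; move: k0; rewrite -hxy ltNge.
    by rewrite fun_ge0.
  under eq_integral do rewrite indic0 mulr0.
  under [RHS]eq_integral do rewrite indic0 mulr0 mul0e.
  by rewrite !integral0.
rewrite ge0_integralZ// integral_indic// setIT nuE//.
rewrite -ge0_integralZ//.
- by apply: eq_integral => x _; rewrite -EFinM mulrA.
- by move=> x; rewrite mulr_ge0.
- exact: measurable_funM.
Qed.

Lemma density_measure mu w : (forall x, 0 <= w x)%R -> measurable_fun setT w ->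
  exists nu : {measure set T -> \bar R},
    forall A, measurable A -> nu A = \int[mu]_x (\1_A x * w x)%:E.
Proof.
move=> w0 mw; pose nu A := \int[mu]_(x in A) (w x)%:E.
have nu0 : nu set0 = 0 by rewrite /nu integral_set0.
have nu_ge0 A : 0 <= nu A by apply: integral_ge0 => x _; rewrite lee_fin.
have nu_sa : semi_sigma_additive nu.
  move=> F mF tF mUF; rewrite /nu ge0_integral_bigcup//.
  - apply: is_cvg_ereal_nneg_natsum_cond => n _ _.
    by apply: integral_ge0 => x _; rewrite lee_fin.
  - by apply/measurable_funTS/measurable_EFinP.
  - by move=> x _; rewrite lee_fin.
pose M := isMeasure.Build _ _ _ nu nu0 nu_ge0 nu_sa.
pose m : {measure set T -> \bar R} := HB.pack nu M.
exists m => A mA; rewrite /m/= /nu integral_mkcond; apply: eq_integral => x _.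
by rewrite epatch_indic mulrC EFinM.
Qed.

End generic_integrals.

Lemma eq_indic (R : realType) (T T' : Type) (A : set T) (B : set T') x y :
  (A x <-> B y) -> \1_A x = \1_B y :> R.
Proof.
move=> AB; rewrite !indicE; congr (nat_of_bool _)%:R.
by apply/idP/idP => /set_mem H; apply/mem_set/AB.
Qed.

Lemma measure_image d1 d2 (T1 : measurableType d1) (T2 : measurableType d2)
    (R : realType) (mu : {measure set T1 -> \bar R}) (g : T1 -> T2) :
  measurable_fun setT g ->
  exists2 nu : {measure set T2 -> \bar R}, (forall A, nu A = mu (g @^-1` A)) &
    forall H : T2 -> R, (forall x, 0 <= H x) -> measurable_fun setT H ->
      (\int[nu]_x (H x)%:E = \int[mu]_x (H (g x))%:E)%E.
Proof.
move=> mg.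
unshelve refine (ex_intro2 _ _ (pushforward mu g : {measure set T2 -> \bar R}) _ _) => //.
move=> H H0 mH; rewrite ge0_integral_pushforward//.
- exact/measurable_EFinP.
- by move=> x _; rewrite lee_fin.
Qed.

(** * Invariance of Lebesgue measure under translation and reflection *)

Section lebesgue_invariance.
Context (R : realType).
Local Notation mu := (@lebesgue_measure R).
Local Open Scope ereal_scope.

(** Preserving the length of half-open intervals is enough, since these determine Lebesgue
    measure. *)
Let integral_pushforward_id (g : R -> R) : measurable_fun setT g ->
  (forall a b : R, (a < b)%R -> mu (g @^-1` `]a, b]%classic) = (b - a)%:E) ->
  forall H : R -> R, (forall x, 0 <= H x)%R -> measurable_fun setT H ->
  \int[mu]_x (H (g x))%:E = \int[mu]_x (H x)%:E.
Proof.
move=> mg gab H H0 mH.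
have [nu nuE Inu] := measure_image mu (mg : measurable_fun (setT : set (measurableTypeR R)) (g : _ -> measurableTypeR R)).
rewrite -Inu//; apply: eq_measure_integral => A mA _; apply/esym.
apply: lebesgue_measure_unique => // X [[a b] _ <-] /=.
rewrite nuE; have [ab|ba] := ltP a b.
  transitivity (b - a)%:E; last exact/esym/gab.
  by rewrite lebesgue_measure_itv/= lte_fin ab.
by rewrite set_itv_ge ?preimage_set0 ?measure0// bnd_simp -leNgt.
Qed.

Lemma le_lebesgue_integral (H1 H2 : R -> R) : (forall x, 0 <= H1 x)%R ->
  measurable_fun setT H1 -> measurable_fun setT H2 ->
  (forall x, H1 x <= H2 x)%R ->
  \int[mu]_x (H1 x)%:E <= \int[mu]_x (H2 x)%:E.
Proof. exact: (@le_ge0_integral _ (measurableTypeR R) R mu). Qed.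

Lemma lebesgue_integralZ (k : R) (H : R -> R) : (0 <= k)%R ->
  (forall x, 0 <= H x)%R -> measurable_fun setT H ->
  \int[mu]_x (k * H x)%:E = k%:E * \int[mu]_x (H x)%:E.
Proof. exact: (@ge0_integralZ _ (measurableTypeR R) R mu). Qed.

Lemma lebesgue_integralD (H1 H2 : R -> R) : (forall x, 0 <= H1 x)%R ->
  (forall x, 0 <= H2 x)%R -> measurable_fun setT H1 -> measurable_fun setT H2 ->
  \int[mu]_x (H1 x + H2 x)%:E = \int[mu]_x (H1 x)%:E + \int[mu]_x (H2 x)%:E.
Proof. exact: (@ge0_integral_add _ (measurableTypeR R) R mu). Qed.

(** Lets an integrand be altered at finitely many points, here the two points where [|x|] meets the
    jump of a Young function. *)
Lemma lebesgue_integral_off_seq (s : seq R) (H1 H2 : R -> R) :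
  (forall x, 0 <= H1 x)%R -> (forall x, 0 <= H2 x)%R ->
  measurable_fun setT H1 -> measurable_fun setT H2 ->
  (forall x, x \notin s -> H1 x = H2 x) ->
  \int[mu]_x (H1 x)%:E = \int[mu]_x (H2 x)%:E.
Proof.
move=> H10 H20 /measurable_EFinP m1 /measurable_EFinP m2 H12.
have cs : countable [set` s] by apply: finite_set_countable; exact: finite_seq.
apply: (@ge0_ae_eq_integral _ (measurableTypeR R) R mu setT) => //.
- by move=> x _; rewrite lee_fin.
- by move=> x _; rewrite lee_fin.
exists [set` s]; split.
- exact: countable_measurable.
- exact: countable_lebesgue_measure0.
- move=> x /= xH; apply: contrapT => /negP xs; apply: xH => _.
  by rewrite /= H12.
Qed.

Lemma integral_lebesgue_shift (h : R) (H : R -> R) : (forall x, 0 <= H x)%R ->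
  measurable_fun setT H ->
  \int[mu]_x (H (x + h)%R)%:E = \int[mu]_x (H x)%:E.
Proof.
apply: integral_pushforward_id => [|a b ab]; first exact: measurable_funD.
have -> : (+%R^~ h) @^-1` `]a, b]%classic = `](a - h)%R, (b - h)%R]%classic.
  by apply/seteqP; split => x /=; rewrite !in_itv/= ltrBlDr lerBrDr.
rewrite lebesgue_measure_itv/= lte_fin ltrD2r ab -EFinB; congr (_%:E).
by rewrite opprB addrA subrK.
Qed.

Lemma integral_lebesgueN (H : R -> R) : (forall x, 0 <= H x)%R ->
  measurable_fun setT H ->
  \int[mu]_x (H (- x)%R)%:E = \int[mu]_x (H x)%:E.
Proof.
apply: integral_pushforward_id => [|a b ab]; first exact: measurable_funN.
have -> : -%R @^-1` `]a, b]%classic = `[(- b)%R, (- a)%R[%classic.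
  by apply/seteqP; split => x /=; rewrite !in_itv/= ltrNr lerNl andbC.
by rewrite lebesgue_measure_itv/= lte_fin ltrN2 ab -EFinB opprK addrC.
Qed.

End lebesgue_invariance.

Section quantile.
Context (R : realType).
Local Notation mu := (@lebesgue_measure R).

(* Inverse transform sampling for a probability measure carried by [0, B];
   the Galois connection in the statement characterises the quantile function. *)
Lemma quantile_transform (nu : {measure set (measurableTypeR R) -> \bar R})
    (B : R) (F : R -> R) :
  0 <= B -> nu setT = 1%E -> nu `]-oo, 0[%classic = 0%E ->
  (forall x, nu `]-oo, x]%classic = (F x)%:E) -> F B = 1 ->
  exists2 Q : R -> R,
    measurable_fun setT Q /\
    (forall u, 0 <= Q u /\ forall x, 0 <= x -> u <= 1 ->
       (Q u <= x) = (u <= F x)) &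
    forall H : R -> R, (forall x, 0 <= H x) -> measurable_fun setT H ->
      (\int[nu]_x (H x)%:E = \int[mu]_x (\1_`]0, 1] x * H (Q x))%:E)%E.
Proof.
move=> B0 nu1 nu0 nuF FB.
have nd x y : x <= y -> F x <= F y.
  move=> xy; rewrite -lee_fin -!nuF le_measure ?inE//; exact: subitvPr.
have nuS x : nu `]x, +oo[%classic = (1 - F x)%:E.
  have E : ((F x)%:E + nu `]x, +oo[%classic = 1)%E.
    rewrite -nuF -measureU//; last first.
      by apply/seteqP; split => // y [] /=; rewrite !in_itv/= andbT => /le_lt_trans H/H; rewrite ltxx.
    rewrite -nu1; congr (nu _); apply/seteqP; split => y //= _.
    by rewrite !in_itv/= andbT; case: leP; [left|right].
  by rewrite EFinB -E addeAC subee ?add0e.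
have F1 x : F x <= 1 by rewrite -lee_fin -nuF -nu1 le_measure ?inE.
have F0 x : 0 <= F x by rewrite -lee_fin -nuF.
(* For [u <= 1] the disjunct [B <= x] adds nothing, since then [F x = 1]. For [u > 1] it keeps [S u]
   nonempty, so that [Q] is monotone, hence measurable, on all of [R]. *)
pose S u := [set x | 0 <= x /\ (u <= F x \/ B <= x)].
have S0 u : S u !=set0 by exists B; split => //; right.
have lS u : lbound (S u) 0 by move=> x [].
have hS u : has_inf (S u) by split=> //; exists 0.
pose Q u := inf (S u).
have Q0 u : 0 <= Q u by apply: lb_le_inf.
have galois u x : 0 <= x -> u <= 1 -> (Q u <= x) = (u <= F x).
  move=> x0 u1; apply/idP/idP; last first.
    move=> uF; apply: ge_inf; first by exists 0.
    by split=> //; left.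
  move=> Qx; apply: le_trans (nd _ _ Qx).
  (* The bound at [Q u] itself comes from right-continuity of [F], that is, continuity of [nu] along
     decreasing left rays. *)
  have QS n : u <= F (Q u + n.+1%:R^-1).
    have [|y [y0 Hy] yQ] := @inf_adherent _ (S u) n.+1%:R^-1 _ (hS u).
      by rewrite invr_gt0.
    apply: (@le_trans _ _ (F y)); last by apply/nd/ltW.
    by case: Hy => // /nd; rewrite FB; exact: le_trans.
  have : nu (`]-oo, (Q u + n.+1%:R^-1)]%classic) @[n --> \oo] --> nu (\bigcap_n `]-oo, (Q u + n.+1%:R^-1)]%classic).
    apply: nonincreasing_cvg_mu => //.
    - by rewrite nuF ltry.
    - by apply: bigcapT_measurable.
    - move=> n m nm; apply/subsetPset; apply: subset_itvl.
      by rewrite bnd_simp lerD2l lef_pV2 ?posrE// ler_nat.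
  rewrite -itvNycEbigcap nuF => cv.
  rewrite -lee_fin -(cvg_lim _ cv)//; apply: lime_ge.
    by apply/cvg_ex; eexists; exact: cv.
  by apply: nearW => n; rewrite nuF lee_fin.
have mQ : measurable_fun setT Q.
  apply: nondecreasing_measurable => // u v uv.
  apply: lb_le_inf => // x [x0 Hx]; apply: ge_inf; first by exists 0.
  by split=> //; case: Hx => [vF|]; [left; exact: le_trans vF|right].
exists Q; first by split=> // u; split; [exact: Q0|exact: galois].
move=> H H0 mH.
have mI : measurable (`]0, 1]%classic : set (measurableTypeR R)) by exact: measurable_itv.
have [m2 m2E Im2] := measure_image (mrestr mu mI) (mQ : measurable_fun (setT : set (measurableTypeR R)) (Q : _ -> measurableTypeR R)).
(* Right rays determine the measure, and on them the Galois connection turns [x < Q u] into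
   [F x < u]; for [x < 0] both sides are 1. *)
have E A : measurable A -> nu A = m2 A.
  move=> mA; apply: (@measure_unique _ R (measurableTypeR R) (@measurable_realfun.RGenOInfty.G R) (fun n => `](- n%:R), +oo[%classic) _ _ _ _ nu m2) => //.
  - exact: measurable_realfun.RGenOInfty.measurableE.
  - move=> _ _ [x ->] [y ->]; exists (Num.max x y).
    by apply/seteqP; split => z /=; rewrite !in_itv/= !andbT gt_max => /andP.
  - by move=> n; exists (- n%:R).
  - apply/seteqP; split=> // x _; exists (Num.truncn (- x)).+1 => //=.
    by rewrite in_itv/= andbT ltrNl truncnS_gt.
  - move=> _ [x ->]; rewrite m2E /mrestr /=.
    have [x0|x0] := leP 0 x.
      transitivity (mu `](F x), 1]%classic); last first.
        congr (mu _).
        apply/seteqP; split => u /=; rewrite !in_itv/= !andbT; last first.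
          by case=> xQ /andP[u0 u1]; rewrite u1 andbT ltNge -galois// -ltNge.
        move=> /andP[Fu u1]; rewrite u1 (le_lt_trans (F0 x) Fu); split => //.
        by rewrite ltNge galois// -ltNge.
      rewrite lebesgue_measure_itv/= lte_fin lt_neqAle F1 andbT.
      rewrite nuS EFinB.
      by case: eqVneq => //= ->; rewrite subee.
    transitivity (mu `]0, 1]%classic); last first.
      congr (mu _); apply/seteqP; split => u /=; rewrite !in_itv/= !andbT; last by case.
      by move=> u01; split => //; exact: lt_le_trans (Q0 u).
    rewrite lebesgue_measure_itv/= lte_fin ltr01 oppr0 adde0.
    rewrite nuS (_ : F x = 0) ?subr0//; apply/eqP; rewrite eq_le F0 andbT.
    rewrite -lee_fin -nuF; apply: (@le_trans _ _ (nu `]-oo, 0[%classic)); last by rewrite nu0.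
    rewrite le_measure ?inE//.
    by move=> y /=; rewrite !in_itv/= => /le_lt_trans; apply.
  - by move=> k; apply: (@le_lt_trans _ _ 1%E); rewrite ?ltry// -nu1 le_measure ?inE.
transitivity (\int[m2]_x (H x)%:E)%E.
  by apply: eq_measure_integral => A mA _; exact: E.
rewrite Im2//.
rewrite (@integral_density _ _ _ mu (mrestr mu mI) (\1_(`]0%R, 1%R]%classic : set R)) _ _ _ (H \o Q))//.
- by apply: eq_integral => x _; rewrite mulrC.
- move=> A mA; transitivity (\int[mu]_x (\1_(A `&` `]0, 1]%classic) x)%:E)%E.
    by rewrite integral_indic ?setIT//; exact: measurableI.
  by apply: eq_integral => x _; rewrite indicI.
- by move=> x /=.
- exact: measurableT_comp.
Qed.

End quantile.

(** * Young functions *)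

Section young.
Context (R : realType) (f : R -> \bar R).
Hypothesis yf : young_function f.
Local Open Scope ereal_scope.

Lemma young_nondecreasing x y : (0 <= x)%R -> (x <= y)%R -> f x <= f y.
Proof.
move=> x0 xy; have [y0|y0] := eqVneq y 0%R.
  by rewrite (_ : x = y)//; apply/eqP; rewrite eq_le xy y0.
have yp : (0 < y)%R by rewrite lt_neqAle eq_sym y0 (le_trans x0).
have t01 : (0 <= x / y <= 1)%R by rewrite divr_ge0 ?(ltW yp)//= ler_pdivrMr// mul1r.
have := young_convex yf (ltW yp) (lexx 0%R) t01.
rewrite mulr0 addr0 divfK// (young0 yf) mule0 adde0 => /le_trans; apply.
rewrite -[leRHS]mul1e; apply: lee_wpmul2r; first by apply: young_ge0 => //; exact: ltW.
by rewrite lee_fin; case/andP: t01.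
Qed.

(* Stated without subtraction because [f] may take the value [+oo]. *)
Lemma young_increment x y t (e : R) : (0 <= x)%R -> (x <= y)%R -> (0 <= t)%R ->
  (0 <= e)%R -> f x + e%:E <= f y -> f (x + t)%R + e%:E <= f (y + t)%R.
Proof.
move=> x0 xy t0 e0 H.
have [xyE|xyn] := eqVneq x y.
  subst y; have [->|fy] := eqVneq (f (x + t)%R) +oo; first by rewrite leey.
  have le1 : f x <= f (x + t)%R by apply: young_nondecreasing => //; rewrite lerDl.
  have ge0 := young_ge0 yf x0.
  move: H ge0 le1 fy; case: (f x) => [a| |] //; case: (f (x + t)%R) => [b| |] //.
  by rewrite -!EFinD !lee_fin => H _ _ _; lra.
have [fyE|fy] := eqVneq (f (y + t)%R) +oo; first by rewrite fyE leey.
have L0 : (0 < y + t - x)%R.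
  have : (x < y)%R by rewrite lt_neqAle xyn.
  by move=> ?; lra.
have yt0 : (0 <= y + t)%R by lra.
have xyt : (x <= y + t)%R by lra.
pose l : R := (t / (y + t - x))%R.
have l01 : (0 <= l <= 1)%R.
  rewrite /l divr_ge0// ?(ltW L0)//= ler_pdivrMr// mul1r; lra.
have c1 := young_convex yf x0 yt0 l01.
have l01' : (0 <= 1 - l <= 1)%R by lra.
have c2 := young_convex yf x0 yt0 l01'.
have E1 : (l * x + (1 - l) * (y + t) = y)%R by rewrite /l; field; rewrite gt_eqF.
have E2 : ((1 - l) * x + (1 - (1 - l)) * (y + t) = x + t)%R.
  by rewrite /l; field; rewrite gt_eqF.
rewrite E1 in c1; rewrite E2 in c2.
have b1 : f x <= f (y + t)%R by exact: young_nondecreasing.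
have b2 : f y <= f (y + t)%R by apply: young_nondecreasing; lra.
have b3 : f (x + t)%R <= f (y + t)%R by apply: young_nondecreasing; lra.
have g1 : 0 <= f x by exact: young_ge0.
have g2 : 0 <= f y by apply: young_ge0 => //; lra.
have g3 : 0 <= f (x + t)%R by apply: young_ge0 => //; lra.
move: H c1 c2 fy b1 b2 b3 g1 g2 g3.
case: (f (y + t)%R) => [d| |] //; case: (f x) => [a| |] //; case: (f y) => [b| |] //;
 case: (f (x + t)%R) => [c| |] //.
rewrite -!EFinM -!EFinD !lee_fin => H c1 c2 *; lra.
Qed.

(** Convexity and [f 0 = 0] give [k * f x1 <= f (k * x1)] for [k >= 1], so one nonzero value forces
    linear growth. With [c = f x1], the chosen [k] makes [k * c = c + max 0 s], which exceeds
    [s]. *)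
Lemma young_unbounded (s : R) : exists2 B : R, (0 < B)%R & forall x, (B <= x)%R -> s%:E < f x.
Proof.
have [x1 x10 fx1] := young_neq0 yf.
have x1p : (0 < x1)%R.
  rewrite lt_neqAle x10 andbT; apply/eqP => x1E.
  by apply: fx1; rewrite -x1E (young0 yf).
have f0 : 0 <= f x1 by exact: young_ge0.
suff [B B0 HB] : exists2 B : R, (0 < B)%R & s%:E < f B.
  exists B => // x Bx; apply: (lt_le_trans HB).
  by apply: young_nondecreasing => //; exact: ltW.
case fE : (f x1) => [c| |]; last by rewrite fE in f0.
  have c0 : (0 < c)%R.
    rewrite lt_neqAle; rewrite fE lee_fin in f0; rewrite f0 andbT.
    by apply/eqP => c0; apply: fx1; rewrite fE -c0.
  pose k : R := (1 + Num.max 0 s / c)%R.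
  have m0 : (0 <= Num.max 0 s / c)%R by rewrite divr_ge0 ?le_max ?lexx// ltW.
  have k1 : (1 <= k)%R by rewrite /k lerDl.
  have k0 : (0 < k)%R by lra.
  exists (k * x1)%R; first exact: mulr_gt0.
  have kx : (0 <= k * x1)%R by rewrite mulr_ge0// ltW.
  have t01 : (0 <= k^-1 <= 1)%R by rewrite invr_ge0 (ltW k0)/= invf_le1.
  have := young_convex yf kx (lexx 0%R) t01.
  rewrite mulr0 addr0 mulKf ?gt_eqF// (young0 yf) mule0 adde0 fE.
  case: (f (k * x1)%R) => [b|_|]; first last.
  - by rewrite gt0_muleNy ?lte_fin ?invr_gt0.
  - by rewrite ltry.
  rewrite -EFinM lee_fin => H; rewrite lte_fin.
  have kc : (k * c <= b)%R by rewrite -(ler_pM2l (_ : (0 < k^-1)%R)) ?invr_gt0// mulKf ?gt_eqF.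
  apply: lt_le_trans kc; rewrite /k mulrDl mul1r divfK ?gt_eqF//.
  have : (s <= Num.max 0 s)%R by rewrite le_max lexx orbT.
  by move=> ?; lra.
by exists x1 => //; rewrite fE ltry.
Qed.

(* [y] is a left discontinuity of [f]; this only happens at the right end of
   the domain where [f] is finite. *)
Definition young_jump (y : R) := (0 < y)%R /\
  exists2 c : R, c%:E < f y & forall z, (0 <= z)%R -> (z < y)%R -> f z <= c%:E.

(** Before a second jump [y'], [f] would still be finite at some [m > y]. Writing [y] as a
    combination of [m], with small weight, and of a point [z < y] brings [f y] arbitrarily close to
    the bound [c] valid on the left of [y]. Without any jump, [b] is arbitrary. *)
Lemma young_jump_unique : exists b, forall y, young_jump y -> y = b.
Proof.
suff no y y' : young_jump y -> young_jump y' -> (y < y')%R -> False.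
  have [[b jb]|nj] := pselect (exists b, young_jump b).
    exists b => y jy; apply/eqP; apply: contrapT => /negP yb.
    by move: yb; rewrite neq_lt => /orP[]; [exact: no jy jb|exact: no jb jy].
  by exists 0%R => y jy; exfalso; apply: nj; exists y.
move=> [y0 [c cf Hc]] [y'0 [c' _ Hc']] yy'.
pose m : R := ((y + y') / 2)%R.
have m0 : (0 < m)%R by rewrite /m; lra.
have ym : (y < m)%R by rewrite /m; lra.
have my' : (m < y')%R by rewrite /m; lra.
have fm := Hc' m (ltW m0) my'.
have fym : f y <= f m by apply: young_nondecreasing; exact: ltW.
have fc0 : 0 <= c%:E.
  by apply: le_trans (Hc 0%R (lexx _) y0); rewrite (young0 yf).
case fmE : (f m) fm fym => [b| |] // _; last first.
  by rewrite leeNy_eq => /eqP fE; move: cf; rewrite fE.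
move: cf; case fyE : (f y) => [a| |] // ca.
rewrite lte_fin in ca; rewrite lee_fin => ab.
have bc : (0 < b - c)%R by lra.
(* The first bound makes [z] below nonnegative; the second makes [t * (b - c)] at most half of the
   gap [a - c]. *)
pose t : R := Num.min (y / m)%R ((a - c) / (2 * (b - c)))%R.
have t0 : (0 < t)%R by rewrite lt_min !divr_gt0//; lra.
have t1 : (t <= y / m)%R by rewrite ge_min lexx.
have t2 : (t <= (a - c) / (2 * (b - c)))%R by rewrite ge_min lexx orbT.
rewrite ler_pdivlMr// in t1; rewrite ler_pdivlMr ?mulr_gt0// in t2.
have tl1 : (t < 1)%R.
  by rewrite -(ltr_pM2r m0) mul1r (le_lt_trans t1).
pose z : R := ((y - t * m) / (1 - t))%R.
have z0 : (0 <= z)%R by rewrite divr_ge0//; lra.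
have zy : (z < y)%R by rewrite ltr_pdivrMr; [nra|lra].
have t01 : (0 <= t <= 1)%R by lra.
have := young_convex yf (ltW m0) z0 t01.
have -> : (t * m + (1 - t) * z = y)%R.
  by rewrite /z; field; rewrite gt_eqF//; lra.
have := Hc z z0 zy.
have := young_ge0 yf z0.
rewrite fyE fmE; case: (f z) => [w| |] //.
rewrite -!EFinM -EFinD !lee_fin => w0 wc H.
have : ((1 - t) * w <= (1 - t) * c)%R by apply: ler_wpM2l; lra.
by nra.
Qed.

Lemma measurable_young_norm : measurable_fun setT (fun x : R => f `|x|%R).
Proof.
apply: (measurability (@measurable_realfun.ErealGenOInfty.G R)).
  exact: measurable_realfun.ErealGenOInfty.measurableE.
move=> _ [_ [r ->] <-]; rewrite setTI.
have -> : (fun x : R => f `|x|%R) @^-1` `]r%:E, +oo[ = ~` [set x : R | f `|x|%R <= r%:E].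
  by apply/seteqP; split => x /=; rewrite in_itv/= andbT ltNge => /negP.
apply: measurableC; apply: is_interval_measurable => x y /= fx fy z /andP[xz zy].
have [zx|zx] := leP `|z|%R `|x|%R.
  by apply: le_trans fx; exact: young_nondecreasing.
apply: le_trans fy; apply: young_nondecreasing => //.
move: zx; have [z0|z0] := leP 0%R z.
  rewrite (ger0_norm z0) => _.
  by apply: (le_trans zy); exact: ler_norm.
rewrite (ltr0_norm z0) ler0_norm; last by lra.
by move=> ?; lra.
Qed.

End young.

(** * Slack weights in one variable *)

Section slack_weight.
Context (R : realType).
Implicit Types (V : R -> R) (f : R -> \bar R) (r s t x : R).
Local Notation mu := (@lebesgue_measure R).

Definition slack_weight V :=
  [/\ forall s, 0 <= V s, forall s, s < 0 -> V s = 0 & {homo V : s t / s <= t}].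

(** The four-point form, stating that [V (s + e) / V s] decreases in [s], avoids logarithms and
    makes sense where [V] vanishes. *)
Definition log_concave V := forall u u' e, u <= u' -> 0 <= e ->
  V (u' + e) * V u <= V (u + e) * V u'.

(** The slack is [-oo] outside the domain of a Young function, where the weight must vanish. The
    value at [+oo] is a convention that breaks monotonicity, hence the side conditions [e != +oo] on
    levels. *)
Definition eweight V (e : \bar R) : R := if e is s%:E then V s else 0.

Definition profile V f r x : R := eweight V (r%:E - f `|x|%R)%E.

Lemma eweight_ge0 V e : slack_weight V -> 0 <= eweight V e.
Proof. by case=> V0 _ _; case: e => /=. Qed.

Lemma eweight_le V e e' : slack_weight V -> e' != +oo%E -> (e <= e')%E ->
  eweight V e <= eweight V e'.
Proof.
move=> wV e'y; have := eweight_ge0 e' wV; case: wV => V0 _ Vnd.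
move: e e' e'y => [s| |] [s'| |] //= _ _; rewrite lee_fin; exact: Vnd.
Qed.

Lemma measurable_eweight V : slack_weight V -> measurable_fun setT (eweight V).
Proof.
case=> V0 _ Vnd.
have -> : eweight V = (fun e => \1_[set e : \bar R | e \is a fin_num] e * V (fine e)).
  apply/funext => -[s| |] /=; rewrite indicE.
  - by rewrite mem_set ?mul1r.
  - by rewrite memNset ?mul0r.
  - by rewrite memNset ?mul0r.
apply: measurable_funM.
  apply: measurable_indic.
  rewrite -[X in measurable X]setTI.
  by apply: measurable_realfun.emeasurable_fin_num => //; exact: measurable_id.
apply: (measurableT_comp (f := V)); last exact: fine_measurable.
by apply: nondecreasing_measurable.
Qed.

Lemma slack_neqy r (e : \bar R) : (0 <= e)%E -> (r%:E - e)%E != +oo%E.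
Proof. by case: e. Qed.

Lemma measurable_set_norm_gt t : measurable [set x : R | t < `|x|].
Proof.
have -> : [set x : R | t < `|x|] = (@Num.norm _ R) @^-1` `]t, +oo[%classic.
  by apply/seteqP; split => x /=; rewrite in_itv/= andbT.
by rewrite -[X in measurable X]setTI; exact: normr_measurable.
Qed.

Lemma measurable_set_norm_le t : measurable [set x : R | `|x| <= t].
Proof.
have -> : [set x : R | `|x| <= t] = ~` [set x : R | t < `|x|].
  by apply/seteqP; split => x /=; rewrite leNgt => /negP.
by apply: measurableC; exact: measurable_set_norm_gt.
Qed.

Section profile.
Context (V : R -> R) (f : R -> \bar R).
Hypotheses (wV : slack_weight V) (yf : young_function f).

Let f0 x : (0 <= f `|x|%R)%E. Proof. exact: young_ge0. Qed.

Lemma profile_ge0 r x : 0 <= profile V f r x.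
Proof. exact: eweight_ge0. Qed.

Lemma profile_homo r r' x : r <= r' -> profile V f r x <= profile V f r' x.
Proof.
by move=> rr'; apply: eweight_le => //; [exact: slack_neqy|rewrite leeD2r ?lee_fin].
Qed.

Lemma profile_le r x : profile V f r x <= V r.
Proof.
have -> : V r = eweight V r%:E by [].
apply: eweight_le => //; rewrite -[leRHS]sube0 leeD2l//.
by rewrite leeN2.
Qed.

Lemma profile_norm r x : profile V f r `|x| = profile V f r x.
Proof. by rewrite /profile normr_id. Qed.

Lemma measurable_profile r : measurable_fun setT (profile V f r).
Proof.
apply: measurableT_comp; first exact: measurable_eweight.
apply: emeasurable_funB => //; exact: measurable_young_norm.
Qed.

Lemma profile_support r :
  exists2 B, 0 < B & forall x, B <= `|x| -> profile V f r x = 0.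
Proof.
have [B B0 HB] := young_unbounded yf r; exists B => // x /HB rf.
rewrite /profile; case: (f `|x|%R) rf => [s| |] //=; rewrite lte_fin => rs.
by case: wV => _ V0 _; apply: V0; rewrite subr_lt0.
Qed.

Lemma profile_dominated r : exists2 B, 0 < B &
  forall x, profile V f r x <= V r * \1_[set x : R | `|x| <= B] x.
Proof.
have [B B0 HB] := profile_support r; exists B => // x.
rewrite indicE; have [xB|xB] := leP `|x| B.
  by rewrite mem_set// mulr1 profile_le.
by rewrite memNset/= ?mulr0 ?HB// ?(ltW xB)//; apply/negP; rewrite -ltNge.
Qed.

Lemma integral_profile_lty r : (\int[mu]_x (profile V f r x)%:E < +oo)%E.
Proof.
have [B B0 HB] := profile_dominated r.
have V0 : 0 <= V r by case: wV.
have mB := @measurable_set_norm_le B.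
apply: le_lt_trans (_ : (_ <= \int[mu]_x (V r * \1_[set x : R | `|x| <= B] x)%:E)%E) _.
  apply: le_lebesgue_integral => //; first exact: profile_ge0.
    exact: measurable_profile.
  by apply: measurable_funM => //; exact: measurable_indic.
rewrite lebesgue_integralZ// integral_indic// setIT.
have E : mu [set x : R | `|x| <= B] = (B + B)%:E.
  have -> : [set x : R | `|x| <= B] = `[(- B)%R, B]%classic.
    by apply/seteqP; split => x /=; rewrite in_itv/= ler_norml.
  by rewrite lebesgue_measure_itv/= lte_fin gtrN// -EFinB opprK.
by rewrite [X in (_ * X)%E](_ : _ = (B + B)%:E) -?EFinM ?ltry.
Qed.

Lemma ge0_integral_le_profile r (H : R -> R) (M : R) :
  (forall x, 0 <= H x <= M) -> measurable_fun setT H ->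
  (\int[mu]_x (H x * profile V f r x)%:E <= M%:E * \int[mu]_x (profile V f r x)%:E)%E.
Proof.
move=> H01 mH; have M0 : 0 <= M by case/andP: (H01 0) => /le_trans; apply.
have mp := measurable_profile r.
have p0 := profile_ge0 r.
rewrite -lebesgue_integralZ//; apply: le_lebesgue_integral => //.
- by move=> x; rewrite mulr_ge0//; case/andP: (H01 x).
- exact: measurable_funM.
- exact: measurable_funM.
- by move=> x; apply: ler_wpM2r => //; case/andP: (H01 x).
Qed.

(** Seen as a function of the level, this is the weight left to the other coordinates once [x] is
    integrated out. *)
Definition mass r : R := fine (\int[mu]_x (profile V f r x)%:E)%E.

Definition tail r t : R :=
  fine (\int[mu]_x (\1_[set x : R | t < `|x|] x * profile V f r x)%:E)%E.

Definition head r t : R :=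
  fine (\int[mu]_x (\1_[set x : R | `|x| <= t] x * profile V f r x)%:E)%E.

Let fin_le r (H : R -> R) : (forall x, 0 <= H x <= 1) -> measurable_fun setT H ->
  (\int[mu]_x (H x * profile V f r x)%:E)%E =
  (fine (\int[mu]_x (H x * profile V f r x)%:E)%E)%:E.
Proof.
move=> H01 mH; rewrite fineK// ge0_fin_numE; last first.
  apply: integral_ge0 => x _; rewrite lee_fin mulr_ge0 ?profile_ge0//.
  by case/andP: (H01 x).
apply: le_lt_trans (ge0_integral_le_profile r H01 mH) _.
by rewrite mul1e integral_profile_lty.
Qed.

Let ind01 (A : set R) x : 0 <= (\1_A x : R) <= 1.
Proof. by rewrite indicE; case: (_ \in _); rewrite /= ?lexx ler01. Qed.

Lemma massE r : (\int[mu]_x (profile V f r x)%:E)%E = (mass r)%:E.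
Proof.
rewrite fineK// ge0_fin_numE ?integral_profile_lty//.
by apply: integral_ge0 => x _; rewrite lee_fin profile_ge0.
Qed.

Lemma tailE r t : (\int[mu]_x (\1_[set x : R | t < `|x|] x * profile V f r x)%:E)%E = (tail r t)%:E.
Proof. by apply: fin_le; [exact: ind01|apply: measurable_indic; exact: measurable_set_norm_gt]. Qed.

Lemma headE r t : (\int[mu]_x (\1_[set x : R | `|x| <= t] x * profile V f r x)%:E)%E = (head r t)%:E.
Proof. by apply: fin_le; [exact: ind01|apply: measurable_indic; exact: measurable_set_norm_le]. Qed.

Lemma mass_ge0 r : 0 <= mass r.
Proof. by apply/fine_ge0/integral_ge0 => x _; rewrite lee_fin profile_ge0. Qed.

Lemma tail_ge0 r t : 0 <= tail r t.
Proof.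
apply/fine_ge0/integral_ge0 => x _; rewrite lee_fin mulr_ge0 ?profile_ge0//.
Qed.

Lemma mass_homo : {homo mass : r s / r <= s}.
Proof.
move=> r s rs; rewrite -lee_fin -!massE; apply: le_lebesgue_integral.
- exact: profile_ge0.
- exact: measurable_profile.
- exact: measurable_profile.
- by move=> x; exact: profile_homo.
Qed.

Lemma mass_neg s : s < 0 -> mass s = 0.
Proof.
move=> s0; rewrite /mass integral0_eq// => x _.
congr (_%:E); apply/eqP; rewrite eq_le profile_ge0 andbT.
by apply: le_trans (profile_le _ _) _; case: wV => _ -> .
Qed.

Lemma slack_weight_mass : slack_weight mass.
Proof. by split; [exact: mass_ge0|exact: mass_neg|exact: mass_homo]. Qed.

Lemma mass_head_tail r t : mass r = head r t + tail r t.
Proof.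
apply: EFin_inj; rewrite EFinD -massE -headE -tailE -lebesgue_integralD.
- apply: eq_integral => x _; congr (_%:E).
  rewrite -mulrDl !indicE; have [xt|xt] := leP `|x| t.
    by rewrite mem_set// memNset/= ?addr0 ?mul1r//; apply/negP; rewrite -leNgt.
  by rewrite memNset/= ?mem_set// ?add0r ?mul1r//; apply/negP; rewrite -ltNge.
- by move=> x; rewrite mulr_ge0// profile_ge0.
- by move=> x; rewrite mulr_ge0// profile_ge0.
- apply: measurable_funM; last exact: measurable_profile.
  by apply: measurable_indic; exact: measurable_set_norm_le.
- apply: measurable_funM; last exact: measurable_profile.
  by apply: measurable_indic; exact: measurable_set_norm_gt.
Qed.

(** Inverse sampling for [|x|] under the normalised profile: passing to the absolute value puts the
    law on some [[0, B]], where [f] is monotone. *)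
Lemma profile_quantile r : 0 < mass r ->
  exists F Q : R -> R, [/\ measurable_fun setT Q, forall u, 0 <= Q u,
    forall u x, 0 <= x -> u <= 1 -> (Q u <= x) = (u <= F x),
    forall t, mass r * F t = head r t &
    forall H : R -> R, (forall x, 0 <= H x) -> measurable_fun setT H ->
      (\int[mu]_x (H `|x| * profile V f r x)%:E =
       (mass r)%:E * \int[mu]_u (\1_`]0, 1] u * H (Q u))%:E)%E].
Proof.
move=> m0; pose w x := (mass r)^-1 * profile V f r x.
have mi0 : 0 <= (mass r)^-1 by rewrite invr_ge0 ltW.
have p0 := profile_ge0 r.
have mp := measurable_profile r.
have w0 x : 0 <= w x by rewrite mulr_ge0.
have mw : measurable_fun setT w by apply: measurable_funM.
have [nu0 nu0E] := @density_measure _ (measurableTypeR R) R mu w w0 mw.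
have Inu0 := @integral_density _ (measurableTypeR R) R mu nu0 w w0 mw nu0E.
have [nu nuE Inu] := @measure_image _ _ (measurableTypeR R) (measurableTypeR R) R nu0 (@Num.norm _ R) (@normr_measurable R setT).
have nuI (H : R -> R) : (forall x, 0 <= H x) -> measurable_fun setT H ->
   (\int[nu]_x (H x)%:E = ((mass r)^-1)%R%:E * \int[mu]_x (H `|x| * profile V f r x)%:E)%E.
  move=> H0 mH.
  have mHn : measurable_fun setT (fun x : R => H `|x|) by apply: measurableT_comp.
  rewrite Inu// Inu0// -lebesgue_integralZ//.
  - by apply: eq_integral => x _; rewrite /w mulrCA.
  - by move=> x; rewrite mulr_ge0.
  - exact: measurable_funM.
have nuA (A : set R) : measurable A -> nu A = (((mass r)^-1)%R%:E * \int[mu]_x (\1_A `|x| * profile V f r x)%:E)%E.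
  by move=> mA; rewrite -nuI// integral_indic// setIT.
have [B B0 HB] := profile_support r.
pose F t := (mass r)^-1 * head r t.
have nuF t : nu `]-oo, t]%classic = (F t)%:E.
  by rewrite nuA// /F EFinM -headE; congr (_ * _)%E.
have headB t : B <= t -> head r t = mass r.
  move=> Bt; apply: EFin_inj; rewrite -headE -massE; apply: eq_integral => x _.
  congr (_%:E); rewrite indicE; have [xt|xt] := leP `|x| t.
    by rewrite mem_set ?mul1r.
  by rewrite HB ?mulr0// ltW// (le_lt_trans Bt).
have [Q [mQ HQ] IQ] : exists2 Q : R -> R,
    measurable_fun setT Q /\
    (forall u, 0 <= Q u /\ forall x, 0 <= x -> u <= 1 ->
       (Q u <= x) = (u <= F x)) &
    forall H : R -> R, (forall x, 0 <= H x) -> measurable_fun setT H ->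
      (\int[nu]_x (H x)%:E = \int[mu]_x (\1_`]0, 1] x * H (Q x))%:E)%E.
  apply: (@quantile_transform R nu B F (ltW B0)) => //.
  - rewrite nuA// -[RHS](_ : ((mass r)^-1 * mass r)%:E = 1%E); last first.
      by rewrite mulVf ?gt_eqF.
    rewrite EFinM -massE; congr (_ * _)%E; apply: eq_integral => x _.
    by rewrite indicT mul1r.
  - rewrite nuA// integral0_eq ?mule0// => x _.
    rewrite indicE memNset ?mul0r//= in_itv/=.
    by apply/negP; rewrite -leNgt.
  - by rewrite /F headB// mulVf ?gt_eqF.
exists F, Q; split => //.
- by move=> u; case: (HQ u).
- by move=> u x; case: (HQ u) => _; apply.
- by move=> t; rewrite /F mulrA divff ?mul1r// gt_eqF.
- by move=> H H0 mH; rewrite -IQ// nuI// muleA -EFinM divff ?mul1e// gt_eqF.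
Qed.

End profile.
End slack_weight.

(** * Coupling two levels *)

Section core.
Context (R : realType) (V : R -> R) (f : R -> \bar R).
Hypotheses (wV : slack_weight V) (yf : young_function f).
Local Notation mu := (@lebesgue_measure R).
Local Notation w := (profile V f).
Local Notation N := (mass V f).

(* Translating by [y - x] maps the tail beyond [x] onto the tail beyond [y], and
   by convexity the slack decreases along the way. *)
Lemma tail_shift (r r' x y : R) : r <= r' -> 0 <= x -> x <= y ->
  (f x + (r' - r)%:E <= f y)%E -> tail V f r' y <= tail V f r x.
Proof.
move=> rr' x0 xy fxy.
have mw s : measurable_fun setT (w s) by exact: measurable_profile.
have w0 s z : 0 <= w s z by exact: profile_ge0.
have mP (t : R) : measurable (`]t, +oo[%classic : set R) by exact: measurable_itv.
have mT (t s : R) : measurable_fun setT (fun z => \1_(`]t, +oo[%classic : set R) z * w s z).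
  by apply: measurable_funM => //; exact: measurable_indic.
have T0 (t s z : R) : 0 <= \1_(`]t, +oo[%classic : set R) z * w s z.
  by rewrite mulr_ge0.
(* The tail is twice its right half, and only on the right half does translation move [|z|] by a
   constant. *)
have half s t : 0 <= t -> ((tail V f s t)%:E =
    \int[mu]_z (\1_(`]t, +oo[%classic : set R) z * w s z)%:E +
    \int[mu]_z (\1_(`]t, +oo[%classic : set R) z * w s z)%:E)%E.
  move=> t0; rewrite -tailE//.
  rewrite -{2}(@integral_lebesgueN R (fun z => \1_(`]t, +oo[%classic : set R) z * w s z))//.
  rewrite -lebesgue_integralD//; last first.
    exact: (measurableT_comp (mT t s)).
  apply: eq_integral => z _; congr (_%:E).
  rewrite -[w s (- z)]profile_norm normrN profile_norm -mulrDl; congr (_ * _).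
  case: (leP 0 z) => z0.
    rewrite [X in _ = _ + X](_ : _ = 0); last first.
      by rewrite indicE memNset//= in_itv/= andbT; apply/negP; rewrite -leNgt; lra.
    by rewrite addr0; apply: eq_indic; rewrite /= in_itv/= andbT ger0_norm.
  rewrite [X in _ = X + _](_ : _ = 0); last first.
    by rewrite indicE memNset//= in_itv/= andbT; apply/negP; rewrite -leNgt; lra.
  by rewrite add0r; apply: eq_indic; rewrite /= in_itv/= andbT ltr0_norm.
rewrite -lee_fin half ?(le_trans x0)// half//.
suff: (\int[mu]_z (\1_(`]y, +oo[%classic : set R) z * w r' z)%:E <=
    \int[mu]_z (\1_(`]x, +oo[%classic : set R) z * w r z)%:E)%E by move=> H; exact: leeD.
rewrite -(@integral_lebesgue_shift R (y - x)) //.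
apply: le_lebesgue_integral => //.
  by apply: (measurableT_comp (mT y r')); exact: measurable_funD.
move=> z.
have -> : \1_(`]y, +oo[%classic : set R) (z + (y - x)) = \1_(`]x, +oo[%classic : set R) z :> R.
  by apply: eq_indic; rewrite /= !in_itv/= !andbT; split; lra.
rewrite !indicE.
have [/set_mem zx|zx] := boolP (z \in `]x, +oo[%classic); last by rewrite !mul0r.
rewrite !mul1r; move: zx; rewrite /= in_itv/= andbT => xz.
apply: eweight_le => //.
  by apply: slack_neqy; exact: young_ge0.
have e0 : 0 <= r' - r by rewrite subr_ge0.
have zx0 : 0 <= z - x by lra.
have := young_increment yf x0 xy zx0 e0 fxy.
have -> : x + (z - x) = `|z| by rewrite ger0_norm; lra.
have -> : y + (z - x) = `|z + (y - x)| by rewrite ger0_norm; lra.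
have := young_ge0 yf (normr_ge0 z).
case: (f `|z|) => [a| |]//; case: (f `|z + (y - x)|) => [b| |]//=;
  rewrite ?addeNy ?leNye//.
by rewrite -EFinD !lee_fin => a0 ab; lra.
Qed.

(* Stochastic monotonicity in [r] of the laws with density proportional to
   [w r]; the normalising constants are cross-multiplied since they may vanish. *)
Lemma head_mass_le (r r' t : R) : log_concave V -> r <= r' ->
  head V f r' t * N r <= head V f r t * N r'.
Proof.
move=> lc rr'; rewrite !(mass_head_tail wV yf _ t) !mulrDr.
(* The products of two heads cancel. *)
suff: head V f r' t * tail V f r t <= head V f r t * tail V f r' t by nra.
have mw s : measurable_fun setT (w s) by exact: measurable_profile.
have w0 s z : 0 <= w s z by exact: profile_ge0.
pose A := [set x : R | `|x| <= t]; pose B := [set x : R | t < `|x|].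
have mA : measurable A by exact: measurable_set_norm_le.
have mB : measurable B by exact: measurable_set_norm_gt.
have mAw s : measurable_fun setT (fun z => \1_A z * w s z).
  by apply: measurable_funM => //; exact: measurable_indic.
have mBw s : measurable_fun setT (fun z => \1_B z * w s z).
  by apply: measurable_funM => //; exact: measurable_indic.
have A0 s z : 0 <= \1_A z * w s z by rewrite mulr_ge0.
have B0 s z : 0 <= \1_B z * w s z by rewrite mulr_ge0.
(* For [|x| <= t < |y|] this is log-concavity at the slacks [r - f |y| <= r - f |x|] with increment
   [r' - r], integrated in [y]; the integration in [x] follows. *)
have tail_le x : A x -> w r' x * tail V f r t <= w r x * tail V f r' t.
  move=> Ax; rewrite -lee_fin !EFinM -!tailE// -!lebesgue_integralZ//.
  apply: le_lebesgue_integral => [y|||y].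
  - by rewrite mulr_ge0// B0.
  - exact: measurable_funM.
  - exact: measurable_funM.
  rewrite mulrCA [leRHS]mulrCA; have [/set_mem By|By] := boolP (y \in B); last first.
    by rewrite indicE (negbTE By) !mul0r.
  apply: ler_wpM2l => //.
  have xy : `|x| <= `|y| by rewrite ltW// (le_lt_trans Ax).
  have := young_nondecreasing yf (normr_ge0 x) xy.
  rewrite /profile; have := young_ge0 yf (normr_ge0 x).
  case: (f `|x|) => [a| |]//; case: (f `|y|) => [b| |]//=; rewrite ?mulr0 ?mul0r//.
  rewrite !lee_fin => a0 ab.
  have := lc (r - b) (r - a) (r' - r).
  have -> : r - a + (r' - r) = r' - a by ring.
  have -> : r - b + (r' - r) = r' - b by ring.
  move=> H; rewrite [leRHS]mulrC; apply: H; lra.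
rewrite -lee_fin (EFinM (head V f r' t)) (EFinM (head V f r t)).
rewrite -(headE wV yf r' t) -(headE wV yf r t).
rewrite [leLHS]muleC [leRHS]muleC -!lebesgue_integralZ// ?tail_ge0//.
apply: le_lebesgue_integral => [x|||x].
- by rewrite mulr_ge0 ?tail_ge0// A0.
- exact: measurable_funM.
- exact: measurable_funM.
have [/set_mem Ax|Ax] := boolP (x \in A); last first.
  by rewrite indicE (negbTE Ax) !mul0r !mulr0.
by rewrite mulrCA [leRHS]mulrCA; apply: ler_wpM2l => //; rewrite mulrC [leRHS]mulrC tail_le.
Qed.

(* Quantile coupling of the laws with densities proportional to [w r] and [w r']:
   both the coordinate and the slack increase along it. *)
Lemma profile_coupling (r r' M : R) (H H' : R -> R) : r <= r' ->
  (forall x, 0 <= H x <= M) -> (forall x, 0 <= H' x) ->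
  measurable_fun setT H -> measurable_fun setT H' ->
  (forall x y, 0 <= x -> 0 <= y -> (f y <= f x + (r' - r)%:E)%E ->
     (log_concave V -> x <= y) -> H x <= H' y) ->
  (\int[mu]_x (H `|x| * w r x)%:E * (N r')%:E <=
   \int[mu]_x (H' `|x| * w r' x)%:E * (N r)%:E)%E.
Proof.
move=> rr' H0M H'0 mH mH' HH'.
have H0 x : 0 <= H x by case/andP: (H0M x).
have mw s : measurable_fun setT (w s) by exact: measurable_profile.
have w0 s z : 0 <= w s z by exact: profile_ge0.
have mHn : measurable_fun setT (fun x : R => H `|x|) by apply: measurableT_comp.
have mHn' : measurable_fun setT (fun x : R => H' `|x|) by apply: measurableT_comp.
have I0 s : (0 <= \int[mu]_x (H' `|x| * w s x)%:E)%E.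
  by apply: integral_ge0 => x _; rewrite lee_fin mulr_ge0.
have [rE|rr] := eqVneq r r'.
  subst r'; apply: lee_wpmul2r; first by rewrite lee_fin mass_ge0.
  apply: le_lebesgue_integral => [x|||x].
  - by rewrite mulr_ge0.
  - exact: measurable_funM.
  - exact: measurable_funM.
  - by apply: ler_wpM2r => //; apply: HH' => //; rewrite subrr adde0.
have ltrr : r < r' by rewrite lt_neqAle rr.
have [N0|Nn0] := eqVneq (N r) 0.
  have -> : (\int[mu]_x (H `|x| * w r x)%:E = 0)%E.
    apply/eqP; rewrite eq_le; apply/andP; split; last first.
      by apply: integral_ge0 => x _; rewrite lee_fin mulr_ge0.
    have := @ge0_integral_le_profile R V f wV yf r (fun x => H `|x|) M.
    by rewrite massE// N0 mule0; apply.
  by rewrite mul0e mule_ge0// lee_fin mass_ge0.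
have Np : 0 < N r by rewrite lt_neqAle eq_sym Nn0 mass_ge0.
have Np' : 0 < N r' by rewrite (lt_le_trans Np)// mass_homo// ltW.
have [F [Q [mQ Q0 QF FE IQ]]] := profile_quantile wV yf Np.
have [F' [Q' [mQ' Q0' QF' FE' IQ']]] := profile_quantile wV yf Np'.
have [b Hb] := young_jump_unique yf.
have M0 : 0 <= M by case/andP: (H0M 0) => /le_trans; apply.
(* At the jump [b] the slack comparison may fail. Adding the bound [M] of [H] there makes the
   inequality trivial at [b], and the integral does not see it. *)
pose H2 y := H' y + M * \1_[set b] y.
have H20 y : 0 <= H2 y by rewrite addr_ge0// mulr_ge0.
have mH2 : measurable_fun setT H2.
  by apply: measurable_funD => //; apply: measurable_funM => //; exact: measurable_indic.
have IH2 : (\int[mu]_x (H' `|x| * w r' x)%:E = \int[mu]_x (H2 `|x| * w r' x)%:E)%E.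
  apply: (lebesgue_integral_off_seq (s := [:: b; - b])) => [x|x|||x].
  - by rewrite mulr_ge0.
  - by rewrite mulr_ge0.
  - exact: measurable_funM.
  - by apply: measurable_funM => //; apply: measurableT_comp.
  - rewrite !inE negb_or => /andP[/eqP xb /eqP xb'].
    rewrite /H2 indicE memNset ?mulr0 ?addr0//= => xE.
    by move: xE; case: (leP 0 x) => x0; [rewrite ger0_norm|rewrite ltr0_norm// => E; apply: xb'; rewrite -E opprK].
rewrite IH2 IQ// IQ'// muleAC [leRHS]muleAC (muleC (N r')%:E).
apply: lee_wpmul2l; first by rewrite -EFinM lee_fin mulr_ge0// mass_ge0.
have mQI (G q : R -> R) : measurable_fun setT G -> measurable_fun setT q ->
    measurable_fun setT (fun u : R => \1_(`]0, 1]%classic : set R) u * G (q u)).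
  move=> mG mq; apply: measurable_funM; first by apply: measurable_indic; exact: measurable_itv.
  exact: measurableT_comp.
apply: le_lebesgue_integral => [u|||u].
- by rewrite mulr_ge0.
- exact: mQI.
- exact: mQI.
have [/set_mem /=|uI] := boolP (u \in (`]0, 1]%classic : set R)); last first.
  by rewrite indicE (negbTE uI) !mul0r.
rewrite in_itv/= => /andP[u0 u1]; apply: ler_wpM2l => //.
set x := Q u; set y := Q' u.
have x0 : 0 <= x := Q0 u; have y0 : 0 <= y := Q0' u.
have uFx : u <= F x by rewrite -QF.
have uFy : u <= F' y by rewrite -QF'.
have [jy|njy] := pselect (young_jump f y).
  rewrite /H2 (Hb _ jy) indicE mem_set//= mulr1.
  by apply: (@le_trans _ _ M); [case/andP: (H0M x)|rewrite lerDr].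
apply: (@le_trans _ _ (H' y)); last by rewrite lerDl mulr_ge0.
have nN : 0 < N r * N r' by exact: mulr_gt0.
apply: HH' => //; last first.
  (* [head_mass_le] says [F' y <= F y], so [u <= F' y] gives [u <= F y], that is, [Q u <= y]. *)
  move=> lc; rewrite QF//; apply: le_trans uFy _.
  rewrite -(ler_pM2l nN).
  have := head_mass_le y lc rr'; rewrite -FE -FE'.
  by congr (is_true (_ <= _)); ring.
(* A drop of the slack would make [y] a jump with bound [f x + (r' - r)]: a [z < y] with [f z] above
   this bound satisfies [F x <= F' z] by [tail_shift], hence [u <= F' z] and [y <= z]. *)
rewrite leNgt; apply/negP => fxy.
have fx0 := young_ge0 yf x0.
case fxE : (f x) fx0 fxy => [a| |]// a0 fxy; last first.
  by move: fxy; rewrite addye// ltNge leey.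
apply: njy; split.
  rewrite lt_neqAle y0 andbT; apply/eqP => yE; move: fxy.
  by rewrite -yE (young0 yf) -EFinD lte_fin; rewrite lee_fin in a0; lra.
exists (a + (r' - r)) => // z z0 zy.
rewrite leNgt; apply/negP => fz.
have xz : x <= z.
  rewrite leNgt; apply/negP => zx.
  have := young_nondecreasing yf z0 (ltW zx); rewrite fxE => /(lt_le_trans fz).
  by rewrite lte_fin; lra.
have T1 : tail V f r' z <= tail V f r x.
  by apply: tail_shift => //; rewrite fxE; exact: ltW.
suff : y <= z by rewrite leNgt zy.
rewrite QF'//; apply: (le_trans uFx); rewrite -(ler_pM2l nN).
have E1 : N r * F x = N r - tail V f r x by rewrite FE (mass_head_tail wV yf r x) addrK.
have E2 : N r' * F' z = N r' - tail V f r' z by rewrite FE' (mass_head_tail wV yf r' z) addrK.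
have Nle : N r <= N r' by exact: mass_homo.
have T0 : 0 <= tail V f r x by exact: tail_ge0.
have -> : N r * N r' * F x = N r' * (N r - tail V f r x) by rewrite -E1; ring.
have -> : N r * N r' * F' z = N r * (N r' - tail V f r' z) by rewrite -E2; ring.
nra.
Qed.

End core.

Section log_concave_mass.
Context (R : realType) (V : R -> R) (f : R -> \bar R).
Hypotheses (wV : slack_weight V) (lc : log_concave V) (yf : young_function f).

(* [mass u / mass (u + e)] is the mean of the nondecreasing function
   [s |-> V (s - e) / V s] of the slack, which increases with [u]. *)
Lemma log_concave_mass : log_concave (mass V f).
Proof.
move=> u u' e uu' e0; case: (wV) => V0 Vneg Vnd.
(* Where [V s = 0] the quotient is 0 and [sigma s * V s = V (s - e)] persists, because
   [V (s - e) <= V s]. Log-concavity of [V] makes [sigma] nondecreasing, so [sigma] is a slack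
   weight bounded by 1. *)
pose sigma s := V (s - e) / V s.
have sigmaV s : sigma s * V s = V (s - e).
  rewrite /sigma; have [Vs|Vs] := eqVneq (V s) 0; last by rewrite divfK.
  rewrite Vs mulr0; apply/esym/eqP; rewrite eq_le V0 andbT -Vs.
  by apply: Vnd; rewrite gerBl.
have wsigma : slack_weight sigma.
  split=> [s|s s0|s t st]; first by rewrite divr_ge0.
    by rewrite /sigma Vneg ?mul0r//; lra.
  rewrite /sigma; have [Vs|Vs] := eqVneq (V s) 0.
    by rewrite Vs invr0 mulr0 divr_ge0.
  have Vs0 : 0 < V s by rewrite lt_neqAle eq_sym Vs V0.
  have Vt0 : 0 < V t by rewrite (lt_le_trans Vs0)// Vnd.
  rewrite ler_pdivrMr// mulrAC ler_pdivlMr//.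
  have := @lc (s - e) (t - e) e; rewrite !subrK => H.
  by rewrite mulrC [leRHS]mulrC [leRHS]mulrC; apply: le_trans (H _ e0) _; [lra|rewrite mulrC].
have sigma1 s : sigma s <= 1.
  rewrite /sigma; have [->|Vs] := eqVneq (V s) 0; first by rewrite invr0 mulr0.
  have Vs0 : 0 < V s by rewrite lt_neqAle eq_sym Vs V0.
  by rewrite ler_pdivrMr// mul1r Vnd// gerBl.
have ur : u + e <= u' + e by rewrite lerD2r.
(* Reweighting level [r + e] by [sigma] of the slack gives level [r]; this exhibits [mass r] as an
   unnormalised mean at level [r + e]. *)
have E r x : profile sigma f (r + e) `|x| * profile V f (r + e) x = profile V f r x.
  rewrite profile_norm /profile; have := young_ge0 yf (normr_ge0 x).
  case: (f `|x|) => [a| |]//= _; rewrite ?mulr0// sigmaV; congr V; ring.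
have := @profile_coupling R V f wV yf (u + e) (u' + e) 1
  (profile sigma f (u + e)) (profile sigma f (u' + e)) ur.
have Ei r : (\int[lebesgue_measure]_x (profile sigma f (r + e) `|x| * profile V f (r + e) x)%:E = (mass V f r)%:E)%E.
  by rewrite -massE//; apply: eq_integral => x _; rewrite E.
rewrite !Ei -!EFinM lee_fin => H.
rewrite mulrC [leRHS]mulrC; apply: H.
- move=> x; rewrite profile_ge0//= /profile.
  by case: (_ - _)%E => //=; rewrite ler01.
- by move=> x; exact: profile_ge0.
- exact: measurable_profile.
- exact: measurable_profile.
- move=> x y x0 y0 fyx _; apply: eweight_le => //.
    by apply: slack_neqy; exact: young_ge0.
  have := young_ge0 yf y0; have := young_ge0 yf x0; move: fyx.
  rewrite !ger0_norm//.
  case: (f x) => [a| |]//; case: (f y) => [b| |]//=; rewrite ?addeNy ?leNye//.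
  by rewrite -?EFinD !lee_fin => *; lra.
Qed.

End log_concave_mass.

Lemma measurable_pos_inv (R : realType) :
  measurable_fun setT (fun x : R => if 0 < x then x^-1 else 0).
Proof.
apply: (measurability (@measurable_realfun.RGenOInfty.G R)).
  exact: measurable_realfun.RGenOInfty.measurableE.
move=> _ [_ [r ->] <-]; rewrite setTI; apply: is_interval_measurable.
move=> x y /=; rewrite !in_itv/= !andbT => rx ry z /andP[xz zy].
rewrite in_itv/= andbT; move: rx ry.
have [x0|x0] := ltP 0 x.
  have z0 := lt_le_trans x0 xz; have y0 := lt_le_trans z0 zy.
  rewrite z0 y0 => _ ry; apply: (lt_le_trans ry).
  by rewrite lef_pV2 ?posrE.
move=> r0 _; case: ifPn => // z0; apply: (lt_trans r0).
by rewrite invr_gt0.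
Qed.

(** * Weighted integrals over tuples *)

Section lebesgue_tuple_fubini.
Context (R : realType) (m : nat) (F : m.+1.-tuple R -> R).
Hypotheses (F0 : forall t, 0 <= F t) (mF : measurable_fun setT F).
Local Notation mu := (@lebesgue_measure R).
Local Notation mun := (@lebesgue_tuple R m).

Let Fc (p : measurableTypeR R * m.-tuple R) : \bar R := (F (tuple_cons p))%:E.

Let Fc0 p : (0 <= Fc p)%E. Proof. by rewrite lee_fin. Qed.

Let mFc : measurable_fun setT Fc.
Proof. by apply/measurable_EFinP; exact: (measurableT_comp mF (@measurable_tuple_cons R m)). Qed.

Let lebesgue_tuple_cons :
  (\int[@lebesgue_tuple R m.+1]_t (F t)%:E = \int[mu \x mun]_p Fc p)%E.
Proof.
have mE : measurable_fun setT (EFin \o F) by exact/measurable_EFinP.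
have F0' : {in setT, forall y, (0 <= (EFin \o F) y)%E} by move=> y _; rewrite lee_fin.
exact: (@ge0_integral_pushforward _ _ (measurableTypeR R * m.-tuple R)%type (m.+1.-tuple R) R
  (@tuple_cons R m) (@measurable_tuple_cons R m) (mu \x mun)%E setT (EFin \o F) measurableT mE F0').
Qed.

(** This order conditions on the first coordinate; the order of [lebesgue_tuple_fubini2] integrates
    it out and yields the marginal of the others. *)
Lemma lebesgue_tuple_fubini1 : (\int[@lebesgue_tuple R m.+1]_t (F t)%:E =
  \int[mu]_x \int[mun]_t (F (tuple_cons (x, t)))%:E)%E.
Proof.
rewrite lebesgue_tuple_cons.
exact: (@fubini_tonelli1 _ _ (measurableTypeR R) (m.-tuple R) R mu mun Fc mFc Fc0).
Qed.

Lemma lebesgue_tuple_fubini2 : (\int[@lebesgue_tuple R m.+1]_t (F t)%:E =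
  \int[mun]_t \int[mu]_x (F (tuple_cons (x, t)))%:E)%E.
Proof.
rewrite lebesgue_tuple_cons.
exact: (@fubini_tonelli2 _ _ (measurableTypeR R) (m.-tuple R) R mu mun Fc mFc Fc0).
Qed.

Lemma measurable_lebesgue_tuple_fubini1 :
  measurable_fun setT (fun x : R => \int[mun]_t (F (tuple_cons (x, t)))%:E)%E.
Proof.
exact: (@measurable_fun_fubini_tonelli_F _ _ (measurableTypeR R) (m.-tuple R) R mun Fc mFc Fc0).
Qed.

Lemma measurable_lebesgue_tuple_fubini2 :
  measurable_fun setT (fun t => \int[mu]_x (F (tuple_cons (x, t)))%:E)%E.
Proof.
exact: (@measurable_fun_fubini_tonelli_G _ _ (measurableTypeR R) (m.-tuple R) R mu Fc mFc Fc0).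
Qed.

End lebesgue_tuple_fubini.

Section orlicz_integral.
Context (R : realType).
Implicit Types (V : R -> R).
Local Notation mu := (@lebesgue_measure R).

Definition consumption m (phi : 'I_m -> R -> \bar R) (t : m.-tuple R) : \bar R :=
  (\sum_(i < m) phi i `|tnth t i|%R)%E.

Definition all_young m (phi : 'I_m -> R -> \bar R) := forall i, young_function (phi i).

Definition drop_first m (phi : 'I_m.+1 -> R -> \bar R) : 'I_m -> R -> \bar R :=
  fun i => phi (lift ord0 i).

Definition tcons m (x : R) (t : m.-tuple R) : m.+1.-tuple R := tuple_cons (x, t).

Lemma all_young_drop m (phi : 'I_m.+1 -> R -> \bar R) : all_young phi ->
  all_young (drop_first phi).
Proof. by move=> yphi i; exact: yphi. Qed.

Lemma tnth_tcons0 m (x : R) (t : m.-tuple R) : tnth (tcons x t) ord0 = x.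
Proof. by []. Qed.

Lemma tnth_tconsS m (x : R) (t : m.-tuple R) i : tnth (tcons x t) (lift ord0 i) = tnth t i.
Proof. by rewrite tnthS. Qed.

Lemma measurable_tcons m : measurable_fun setT (fun p : R * m.-tuple R => tcons p.1 p.2).
Proof. exact: (measurable_cons (f := fst) (g := snd)). Qed.

Lemma measurable_tcons_r m (x : R) : measurable_fun setT (@tcons m x).
Proof. exact: (measurable_cons (f := cst x) (g := id)). Qed.

Lemma measurable_tcons_l m (t : m.-tuple R) : measurable_fun setT (fun x => tcons x t).
Proof. exact: (measurable_cons (f := id) (g := cst t)). Qed.

Lemma consumption_cons m (phi : 'I_m.+1 -> R -> \bar R) x t :
  consumption phi (tcons x t) = (phi ord0 `|x|%R + consumption (drop_first phi) t)%E.
Proof.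
rewrite /consumption big_ord_recl tnth_tcons0; congr (_ + _)%E.
by apply: eq_bigr => i _; rewrite tnth_tconsS.
Qed.

Lemma consumption_ge0 m (phi : 'I_m -> R -> \bar R) t : all_young phi ->
  (0 <= consumption phi t)%E.
Proof. by move=> yphi; apply: sume_ge0 => i _; apply: young_ge0. Qed.

Lemma measurable_consumption m (phi : 'I_m -> R -> \bar R) : all_young phi ->
  measurable_fun setT (consumption phi).
Proof.
move=> yphi; apply: emeasurable_sum => i.
apply: (measurableT_comp (f := fun x : R => phi i `|x|%R)).
  exact: measurable_young_norm.
exact: measurable_tnth.
Qed.

(** An unnormalised mean of [g]. The level is an extended real because conditioning on a coordinate
    [x] lowers it by [f |x|], which may be infinite. *)
Definition weighted_integral V m (phi : 'I_m -> R -> \bar R) (e : \bar R)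
    (g : m.-tuple R -> R) : \bar R :=
  (\int[@lebesgue_tuple R m]_t (g t * eweight V (e - consumption phi t))%:E)%E.

Local Notation J := weighted_integral.

Section weighted.
Context (V : R -> R).
Hypothesis wV : slack_weight V.

Lemma measurable_weight m (phi : 'I_m -> R -> \bar R) e : all_young phi ->
  measurable_fun setT (fun t => eweight V (e - consumption phi t)).
Proof.
move=> yphi; apply: measurableT_comp; first exact: measurable_eweight.
by apply: emeasurable_funB => //; exact: measurable_consumption.
Qed.

Lemma measurable_weighted m (phi : 'I_m -> R -> \bar R) e (g : m.-tuple R -> R) : all_young phi ->
  measurable_fun setT g ->
  measurable_fun setT (fun t => g t * eweight V (e - consumption phi t)).
Proof. by move=> yphi mg; apply: measurable_funM => //; exact: measurable_weight. Qed.

Lemma slackB (e a b : \bar R) : (0 <= a)%E -> (0 <= b)%E -> (e - (a + b) = e - a - b)%E.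
Proof. by case: e => [e| |]; case: a => [a| |]; case: b => [b| |] //= _ _; rewrite -?EFinB -?EFinD ?opprD ?addrA. Qed.

Lemma weighted_integral_cons m (phi : 'I_m.+1 -> R -> \bar R) e (g : m.+1.-tuple R -> R) : all_young phi ->
  (forall t, 0 <= g t) -> measurable_fun setT g ->
  (J V phi e g =
   \int[mu]_x J V (drop_first phi) (e - phi ord0 `|x|%R) (fun t => g (tcons x t)))%E.
Proof.
move=> yphi g0 mg; rewrite /weighted_integral lebesgue_tuple_fubini1; last 2 first.
- by move=> t; rewrite mulr_ge0// eweight_ge0.
- exact: measurable_weighted.
apply: eq_integral => x _; apply: eq_integral => t _.
rewrite -/(tcons x t) consumption_cons slackB//.
- exact: young_ge0.
- exact/consumption_ge0/all_young_drop.
Qed.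

Lemma measurable_weighted_integral m (phi : 'I_m.+1 -> R -> \bar R) e (g : m.+1.-tuple R -> R) :
  all_young phi -> (forall t, 0 <= g t) -> measurable_fun setT g ->
  measurable_fun setT (fun x : R =>
    J V (drop_first phi) (e - phi ord0 `|x|%R) (fun t => g (tcons x t))).
Proof.
move=> yphi g0 mg.
apply: (eq_measurable_fun (fun x => \int[@lebesgue_tuple R m]_t
    ((g (tuple_cons (x, t)) * eweight V (e - consumption phi (tuple_cons (x, t)))))%:E)%E).
  move=> x _; apply: eq_integral => t _.
  rewrite -/(tcons x t) consumption_cons slackB//.
  - exact: young_ge0.
  - exact/consumption_ge0/all_young_drop.
apply: (@measurable_lebesgue_tuple_fubini1 R m (fun t => g t * eweight V (e - consumption phi t))).
- by move=> t; rewrite mulr_ge0// eweight_ge0.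
- exact: measurable_weighted.
Qed.

(** The integral of the constant 1 as a function of the level, defined by iterating [mass] so that
    the slack-weight properties and log-concavity pass through by induction. *)
Fixpoint total_mass m : ('I_m -> R -> \bar R) -> R -> R :=
  match m with
  | 0 => fun _ => V
  | m'.+1 => fun phi => mass (total_mass (drop_first phi)) (phi ord0)
  end.

Lemma slack_weight_total m (phi : 'I_m -> R -> \bar R) : all_young phi ->
  slack_weight (total_mass phi).
Proof.
elim: m phi => // m IH phi yphi /=; apply: slack_weight_mass => //.
exact/IH/all_young_drop.
Qed.

Lemma log_concave_total m (phi : 'I_m -> R -> \bar R) : log_concave V ->
  all_young phi -> log_concave (total_mass phi).
Proof.
move=> lc; elim: m phi => // m IH phi yphi /=; apply: log_concave_mass => //.
- exact/slack_weight_total/all_young_drop.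
- exact/IH/all_young_drop.
Qed.

Lemma weighted_integral0 (phi : 'I_0 -> R -> \bar R) e (g : 0.-tuple R -> R) :
  measurable_fun setT g ->
  J V phi e g = (g [tuple] * eweight V e)%:E.
Proof.
move=> mg; have yphi : all_young phi by case.
rewrite /weighted_integral /= integral_dirac//; last first.
  by apply/measurable_EFinP; exact: measurable_weighted.
rewrite diracE mem_set// mul1e /consumption big_ord0 sube0.
by congr (_ * _)%:E; congr g; exact: val_inj.
Qed.

Lemma weighted_integral1 m (phi : 'I_m -> R -> \bar R) e : all_young phi ->
  e != +oo%E -> J V phi e (cst 1) = (eweight (total_mass phi) e)%:E.
Proof.
elim: m phi e => [|m IH] phi e yphi ey.
  by rewrite weighted_integral0 ?mul1r.
have ydrop := all_young_drop yphi.
rewrite weighted_integral_cons//.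
have := young_ge0 (yphi ord0).
move: e ey => [e| |]// _ p0.
  transitivity (mass (total_mass (drop_first phi)) (phi ord0) e)%:E => //.
  rewrite -massE; [|exact: slack_weight_total|exact: yphi].
  apply: eq_integral => x _; rewrite IH//.
  by apply: slack_neqy; exact: p0.
by rewrite integral0_eq// => x _; rewrite IH//; have := p0 _ (normr_ge0 x); case: (phi ord0 _).
Qed.

Lemma weighted_integral_ge0 m (phi : 'I_m -> R -> \bar R) e (g : m.-tuple R -> R) :
  (forall t, 0 <= g t) -> (0 <= J V phi e g)%E.
Proof. by move=> g0; apply: integral_ge0 => t _; rewrite lee_fin mulr_ge0// eweight_ge0. Qed.

Lemma weighted_integral_le m (phi : 'I_m -> R -> \bar R) e (g h : m.-tuple R -> R) : all_young phi ->
  (forall t, 0 <= g t) -> measurable_fun setT g -> measurable_fun setT h ->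
  (forall t, g t <= h t) -> (J V phi e g <= J V phi e h)%E.
Proof.
move=> yphi g0 mg mh gh; apply: le_ge0_integral => [t|||t].
- by rewrite mulr_ge0// eweight_ge0.
- exact: measurable_weighted.
- exact: measurable_weighted.
- by apply: ler_wpM2r => //; exact: eweight_ge0.
Qed.

Lemma weighted_integralZ m (phi : 'I_m -> R -> \bar R) e (k : R) (g : m.-tuple R -> R) : all_young phi ->
  0 <= k -> (forall t, 0 <= g t) -> measurable_fun setT g ->
  (J V phi e (fun t => (k * g t)%R) = k%:E * J V phi e g)%E.
Proof.
move=> yphi k0 g0 mg; rewrite /weighted_integral -ge0_integralZ//.
- by apply: eq_integral => t _; rewrite mulrA.
- by move=> t; rewrite mulr_ge0// eweight_ge0.
- exact: measurable_weighted.
Qed.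

Lemma weighted_integralD m (phi : 'I_m -> R -> \bar R) e (g h : m.-tuple R -> R) : all_young phi ->
  (forall t, 0 <= g t) -> (forall t, 0 <= h t) ->
  measurable_fun setT g -> measurable_fun setT h ->
  (J V phi e (fun t => (g t + h t)%R) = J V phi e g + J V phi e h)%E.
Proof.
move=> yphi g0 h0 mg mh; rewrite /weighted_integral -ge0_integral_add//.
- by apply: eq_integral => t _; rewrite mulrDl.
- by move=> t; rewrite mulr_ge0// eweight_ge0.
- by move=> t; rewrite mulr_ge0// eweight_ge0.
- exact: measurable_weighted.
- exact: measurable_weighted.
Qed.

Lemma weighted_integral_bounded m (phi : 'I_m -> R -> \bar R) e (g : m.-tuple R -> R) (C : R) :
  all_young phi -> e != +oo%E ->
  (forall t, 0 <= g t <= C) -> measurable_fun setT g ->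
  (J V phi e g <= (C * eweight (total_mass phi) e)%:E)%E.
Proof.
move=> yphi ey gC mg.
have C0 : 0 <= C by have /andP[] := gC [tuple of nseq m 0]; exact: le_trans.
rewrite EFinM -weighted_integral1// -weighted_integralZ//.
apply: weighted_integral_le => //.
- by move=> t; case/andP: (gC t).
- by apply: measurable_funM; exact: measurable_cst.
- by move=> t; rewrite mulr1; case/andP: (gC t).
Qed.

Lemma weighted_integral_fin m (phi : 'I_m -> R -> \bar R) e (g : m.-tuple R -> R) (C : R) :
  all_young phi -> e != +oo%E ->
  (forall t, 0 <= g t <= C) -> measurable_fun setT g ->
  J V phi e g = (fine (J V phi e g))%:E.
Proof.
move=> yphi ey gC mg; rewrite fineK// ge0_fin_numE; last first.
  by apply: weighted_integral_ge0 => t; case/andP: (gC t).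
exact: le_lt_trans (weighted_integral_bounded yphi ey gC mg) (ltry _).
Qed.

End weighted.
End orlicz_integral.

(** * Stochastic monotonicity in the level, in any dimension *)

Section stochastic_monotonicity.
Context (R : realType) (V : R -> R).
Hypotheses (wV : slack_weight V) (lc : log_concave V).
Local Notation mu := (@lebesgue_measure R).
Local Notation J := (weighted_integral V).

(** This also forces [g] to be invariant under changes of sign of the coordinates. *)
Definition abs_nondecreasing m (g : m.-tuple R -> R) := forall s t,
  (forall i, `|tnth s i| <= `|tnth t i|) -> g s <= g t.

Lemma abs_nondecreasing_tcons m (g : m.+1.-tuple R -> R) x :
  abs_nondecreasing g -> abs_nondecreasing (fun t => g (tcons x t)).
Proof.
move=> ig s t st; apply: ig => i; case: (unliftP ord0 i) => [j|] ->.
  by rewrite !tnth_tconsS.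
by rewrite !tnth_tcons0.
Qed.

Lemma abs_nondecreasing_tcons_le m (g : m.+1.-tuple R -> R) x y t :
  abs_nondecreasing g -> `|x| <= `|y| -> g (tcons x t) <= g (tcons y t).
Proof.
move=> ig xy; apply: ig => i; case: (unliftP ord0 i) => [j|] ->.
  by rewrite !tnth_tconsS.
by rewrite !tnth_tcons0.
Qed.

(* [total_mass V phi] is the normalising constant of the means; it is
   cross-multiplied since it may vanish. *)
Lemma weighted_mean_homo m (phi : 'I_m -> R -> \bar R) (g : m.-tuple R -> R)
    (C r r' : R) :
  all_young phi -> (forall t, 0 <= g t <= C) -> measurable_fun setT g ->
  abs_nondecreasing g -> r <= r' ->
  (J phi r%:E g * (total_mass V phi r')%:E <=
   J phi r'%:E g * (total_mass V phi r)%:E)%E.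
Proof.
elim: m phi g r r' => [|m IH] phi g r r' yphi gC mg ig rr'.
  by rewrite !weighted_integral0//= -!EFinM lee_fin mulrAC.
have ydrop := all_young_drop yphi.
have yf := yphi ord0.
set f := phi ord0 in yf; set phi' := drop_first phi in ydrop.
have wVm : slack_weight (total_mass V phi') by exact: slack_weight_total.
set Vm := total_mass V phi' in wVm.
have g0 t : 0 <= g t by case/andP: (gC t).
have mgx x : measurable_fun setT (fun t => g (tcons x t)).
  by apply: measurableT_comp => //; exact: measurable_tcons_r.
have gCx x t : 0 <= g (tcons x t) <= C by [].
have fin (s x : R) : (s%:E - f `|x|%R)%E != +oo%E by apply: slack_neqy; exact: young_ge0.
pose G (s x : R) := fine (J phi' (s%:E - f `|x|%R)%E (fun t => g (tcons x t))).
have GE (s x : R) : J phi' (s%:E - f `|x|%R)%E (fun t => g (tcons x t)) = (G s x)%:E.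
  exact: (weighted_integral_fin wV ydrop (fin s x) (gCx x) (mgx x)).
have G0 (s x : R) : 0 <= G s x.
  by rewrite -lee_fin -GE; exact: weighted_integral_ge0.
have p0 (s x : R) : 0 <= profile Vm f s x by exact: profile_ge0.
have GC (s x : R) : G s x <= C * profile Vm f s x.
  rewrite -lee_fin -GE.
  exact: (weighted_integral_bounded wV ydrop (fin s x) (gCx x) (mgx x)).
pose inv (z : R) := if 0 < z then z^-1 else 0.
have inv0 z : 0 <= inv z by rewrite /inv; case: ifP => // z0; rewrite invr_ge0 ltW.
(* [H s x] is the mean of [g] at level [s] given the first coordinate [x]. It is 0 where the
   conditioning weight vanishes; there [G s x] vanishes too, by [GC]. *)
pose H (s x : R) := G s x * inv (profile Vm f s x).
have HG (s x : R) : H s x * profile Vm f s x = G s x.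
  rewrite /H /inv; case: ifPn => [z0|]; first by rewrite divfK// gt_eqF.
  rewrite -leNgt => z0; have pE : profile Vm f s x = 0.
    by apply/eqP; rewrite eq_le z0 p0.
  by apply/eqP; rewrite mulr0 mul0r eq_le G0 /=; have := GC s x; rewrite pE mulr0.
have Hn (s x : R) : H s `|x| = H s x.
  rewrite /H profile_norm; congr (_ * _); rewrite /G normr_id; congr (fine (J _ _ _)).
  by apply/funext => t; apply/eqP; rewrite eq_le !abs_nondecreasing_tcons_le ?normr_id.
have HC (s x : R) : 0 <= H s x <= C.
  rewrite mulr_ge0//=; have C0 : 0 <= C by have /andP[] := gC (tcons 0 [tuple of nseq m 0]); exact: le_trans.
  rewrite /H /inv; case: ifPn => [z0|_]; last by rewrite mulr0.
  by rewrite ler_pdivrMr.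
have mG s : measurable_fun setT (G s).
  apply: (measurableT_comp (f := fine)); first exact: fine_measurable.
  exact: (@measurable_weighted_integral R V wV m phi s%:E g).
have mH s : measurable_fun setT (H s).
  apply: measurable_funM => //.
  apply: (measurableT_comp (f := inv)); first exact: measurable_pos_inv.
  exact: measurable_profile.
have JH s : (\int[mu]_x (H s `|x| * profile Vm f s x)%:E = J phi s%:E g)%E.
  rewrite weighted_integral_cons//; apply: eq_integral => x _.
  by rewrite Hn HG -GE.
have := @profile_coupling R Vm f wVm yf r r' C (H r) (H r') rr' (HC r) _ (mH r) (mH r') _.
rewrite !JH; apply.
  by move=> x; case/andP: (HC r' x).
move=> x y x0 y0 fyx xy.
have {}xy : x <= y by apply: xy; exact: log_concave_total.
rewrite {1}/H {1}/inv; case: ifPn => [px|_]; last first.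
  by rewrite mulr0; case/andP: (HC r' y).
have nx : `|x| = x by exact: ger0_norm.
have ny : `|y| = y by exact: ger0_norm.
have [a fa] : exists a, f x = a%:E.
  have := young_ge0 yf x0; move: px; rewrite /profile nx.
  by case: (f x) => [a| |]//=; [exists a|rewrite ltxx].
have [b fb] : exists b, f y = b%:E.
  have := young_ge0 yf y0; move: fyx; rewrite fa.
  by case: (f y) => [b| |]//= _ _; exists b.
have ba : b <= a + (r' - r) by move: fyx; rewrite fa fb.
have pxE : profile Vm f r x = Vm (r - a) by rewrite /profile nx fa.
have pyE : profile Vm f r' y = Vm (r' - b) by rewrite /profile ny fb.
have ee : r - a <= r' - b by lra.
have pxy : profile Vm f r x <= profile Vm f r' y.
  by rewrite pxE pyE; case: wVm => _ _; exact.
have py : 0 < profile Vm f r' y by exact: lt_le_trans px pxy.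
rewrite /H /inv py ler_pdivrMr// mulrAC ler_pdivlMr//.
(* The passage from [H r x] to [H r' y] has two stages: the induction hypothesis raises the slack
   from [r - a] to [r' - b] with first coordinate [x], then [x] is raised to [y]. *)
have := IH phi' (fun t => g (tcons x t)) _ _ ydrop (gCx x) (mgx x) (@abs_nondecreasing_tcons m g x ig) ee.
have GxE : J phi' (r - a)%:E (fun t => g (tcons x t)) = (G r x)%:E.
  by rewrite -GE nx fa.
rewrite GxE -EFinM => Hx; rewrite -lee_fin pyE; apply: (le_trans Hx).
rewrite EFinM pxE; apply: lee_wpmul2r; first by rewrite lee_fin; case: wVm => Vm0 _ _; exact: Vm0.
have -> : (G r' y)%:E = J phi' (r' - b)%:E (fun t => g (tcons y t)).
  by rewrite -GE ny fb.
apply: weighted_integral_le => // t.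
by apply: abs_nondecreasing_tcons_le => //; rewrite nx ny.
Qed.

End stochastic_monotonicity.

(** By Tonelli each double integral equals the one with the variables exchanged, so twice the
    integral is that of the symmetrised integrand. Halving is legitimate because both sides are
    nonnegative, possibly infinite. *)
Lemma symmetrized_integral_le (R : realType) (a b : R -> R -> R) :
  let mu := @lebesgue_measure R in
  (forall x y, 0 <= a x y) -> (forall x y, 0 <= b x y) ->
  measurable_fun setT (fun p : R * R => a p.1 p.2) ->
  measurable_fun setT (fun p : R * R => b p.1 p.2) ->
  (forall x y, a x y + a y x <= b x y + b y x) ->
  (\int[mu]_x \int[mu]_y (a x y)%:E <= \int[mu]_x \int[mu]_y (b x y)%:E)%E.
Proof.
move=> mu a0 b0 ma mb ab.
pose RR := measurableTypeR R.
have swapm (h : R -> R -> R) : measurable_fun setT (fun p : R * R => h p.1 p.2) ->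
    measurable_fun (setT : set (RR * RR)) (fun p => h p.2 p.1).
  move=> mh.
  have sw : measurable_fun (setT : set (R * R)) (fun p => h p.2 p.1).
    apply: (measurableT_comp (f := fun p => h p.1 p.2) mh (g := fun p : R * R => (p.2, p.1))).
    exact: measurable_fun_pair.
  exact: sw.
have int2 (h : R -> R -> R) : (forall x y, 0 <= h x y) ->
    measurable_fun setT (fun p : R * R => h p.1 p.2) ->
    (\int[mu]_x \int[mu]_y (h x y)%:E =
      \int[(mu \x mu)%E]_p (h p.1 p.2)%:E)%E /\
    (\int[mu]_x \int[mu]_y (h x y)%:E =
      \int[(mu \x mu)%E]_p (h p.2 p.1)%:E)%E.
  move=> h0 mh.
  have mh' : measurable_fun (setT : set (RR * RR)) (fun p => (h p.1 p.2)%:E).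
    by apply/measurable_EFinP; exact: mh.
  have h0' (p : RR * RR) : (0 <= (h p.1 p.2)%:E)%E by rewrite lee_fin.
  have ms' : measurable_fun (setT : set (RR * RR)) (fun p => (h p.2 p.1)%:E).
    by apply/measurable_EFinP; exact: swapm.
  have s0' (p : RR * RR) : (0 <= (h p.2 p.1)%:E)%E by rewrite lee_fin.
  split; apply/esym.
    exact: (@fubini_tonelli1 _ _ RR RR R mu mu _ mh' h0').
  exact: (@fubini_tonelli2 _ _ RR RR R mu mu _ ms' s0').
have [a1 a2] := int2 a a0 ma; have [b1 b2] := int2 b b0 mb.
have dbl : (\int[mu]_x \int[mu]_y (a x y)%:E + \int[mu]_x \int[mu]_y (a x y)%:E <=
    \int[mu]_x \int[mu]_y (b x y)%:E + \int[mu]_x \int[mu]_y (b x y)%:E)%E.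
  rewrite {1}a1 a2 {1}b1 b2.
  have E (h : R -> R -> R) : (forall x y, 0 <= h x y) ->
    measurable_fun setT (fun p : R * R => h p.1 p.2) ->
    (\int[(mu \x mu)%E]_p (h p.1 p.2)%:E + \int[(mu \x mu)%E]_p (h p.2 p.1)%:E =
     \int[(mu \x mu)%E]_p (h p.1 p.2 + h p.2 p.1)%:E)%E.
    move=> h0 mh; apply/esym.
    apply: (@ge0_integral_add _ (RR * RR)%type R (mu \x mu)%E (fun p => h p.1 p.2) (fun p => h p.2 p.1)) => //.
    exact: swapm.
  rewrite E// E//.
  apply: (@le_ge0_integral _ (RR * RR)%type R (mu \x mu)%E (fun p => a p.1 p.2 + a p.2 p.1) (fun p => b p.1 p.2 + b p.2 p.1)).
  - by move=> p; rewrite addr_ge0.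
  - by apply: measurable_funD; [exact: ma|exact: swapm].
  - by apply: measurable_funD; [exact: mb|exact: swapm].
  - by move=> p; exact: ab.
move: dbl; set A := (\int[mu]_x _)%E; set B := (\int[mu]_x _)%E.
have A0 : (0 <= A)%E by apply: integral_ge0 => x _; apply: integral_ge0 => y _; rewrite lee_fin.
have B0 : (0 <= B)%E by apply: integral_ge0 => x _; apply: integral_ge0 => y _; rewrite lee_fin.
case: A A0 => [x| |]//; case: B B0 => [y| |]//= _ _; rewrite -?EFinD ?lee_fin ?leey//.
lra.
Qed.

(** * Decoupling the first coordinate *)

Section supermodular.
Context (R : realType).
Local Notation mu := (@lebesgue_measure R).

(** Supermodularity in the absolute values. Quantifying over every [lo] and [hi] with these absolute
    values avoids choosing signs; the case [p = q] shows that [g] ignores signs. *)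
Definition abs_supermodular m (g : m.-tuple R -> R) := forall p q lo hi,
  (forall i, `|tnth lo i| = Num.min `|tnth p i| `|tnth q i|) ->
  (forall i, `|tnth hi i| = Num.max `|tnth p i| `|tnth q i|) ->
  g p + g q <= g lo + g hi.

Lemma abs_supermodular_tcons m (g : m.+1.-tuple R -> R) x :
  abs_supermodular g -> abs_supermodular (fun t => g (tcons x t)).
Proof.
move=> sg p q lo hi loE hiE; apply: sg => i; case: (unliftP ord0 i) => [j|] ->.
- by rewrite !tnth_tconsS.
- by rewrite !tnth_tcons0 minxx.
- by rewrite !tnth_tconsS.
- by rewrite !tnth_tcons0 maxxx.
Qed.

Context (V : R -> R).
Hypothesis wV : slack_weight V.
Local Notation J := (weighted_integral V).

Section first_coordinate.
Context (m : nat) (phi : 'I_m.+1 -> R -> \bar R).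
Hypothesis yphi : all_young phi.
Local Notation f := (phi ord0).
Local Notation phi' := (drop_first phi).
Local Notation Vm := (total_mass V phi').
Local Notation V1 := (mass V f).

Let yf : young_function f. Proof. exact: yphi. Qed.
Let ydrop : all_young phi'. Proof. exact: all_young_drop. Qed.
Let wV1 : slack_weight V1. Proof. exact: slack_weight_mass. Qed.

(** With the other coordinates fixed at [t], the first one sees the level [r - consumption phi' t],
    so its integral is [V1] at that level. *)
Lemma weighted_integral_marginal (r : R) (h : m.-tuple R -> R) (g : m.+1.-tuple R -> R) :
  (forall t, 0 <= h t) -> measurable_fun setT g -> (forall x t, g (tcons x t) = h t) ->
  (J phi r%:E g = weighted_integral V1 phi' r%:E h)%E.
Proof.
move=> h0 mg gh; have g0 t : 0 <= g t.
  rewrite (_ : t = tcons (thead t) [tuple of behead t]) ?gh//.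
  by rewrite /tcons /tuple_cons /=; exact: tuple_eta.
rewrite /weighted_integral lebesgue_tuple_fubini2; last 2 first.
- by move=> t; rewrite mulr_ge0// eweight_ge0.
- exact: measurable_weighted.
apply: eq_integral => t _.
have c0 := consumption_ge0 t ydrop.
under eq_integral => x _.
  rewrite -/(tcons x t) gh consumption_cons (addeC (f _)) slackB//; last exact: young_ge0.
  over.
case: (consumption phi' t) c0 => [c| |]// _.
  rewrite -EFinB /= EFinM -massE// -lebesgue_integralZ//.
  - by move=> x; exact: profile_ge0.
  - exact: measurable_profile.
by rewrite addeNy /= mulr0 integral0_eq.
Qed.

(** The two sides nest the one-variable integrals in different orders; both are the integral of the
    constant 1. *)
Lemma total_mass_marginal (r : R) : total_mass V1 phi' r = total_mass V phi r.
Proof.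
apply: EFin_inj.
have E1 := @weighted_integral1 R V wV m.+1 phi r%:E yphi isT.
have E2 := @weighted_integral1 R V1 wV1 m phi' r%:E ydrop isT.
rewrite [LHS](_ : _ = (eweight (total_mass V1 phi') r%:E)%:E)// -E2.
rewrite [RHS](_ : _ = (eweight (total_mass V phi) r%:E)%:E)// -E1.
by apply/esym/weighted_integral_marginal => // t; exact: ler01.
Qed.

Context (lc : log_concave V) (r C : R) (g : m.+1.-tuple R -> R).
Hypotheses (gC : forall t, 0 <= g t <= C) (mg : measurable_fun setT g).
Local Notation p := (profile Vm f r).

Let g0 t : 0 <= g t. Proof. by case/andP: (gC t). Qed.
Let mgx x : measurable_fun setT (fun t => g (tcons x t)).
Proof. by apply: measurableT_comp => //; exact: measurable_tcons_r. Qed.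
Let fin (x : R) : (r%:E - f `|x|%R)%E != +oo%E.
Proof. by apply: slack_neqy; exact: young_ge0. Qed.
Let wVm : slack_weight Vm. Proof. exact: slack_weight_total. Qed.

(** The first coordinate is [x] inside [g], while the other coordinates have the level left by [y].
    The diagonal gives the dependent law, and off-diagonal values the decoupled one. *)
Let q (x y : R) := fine (J phi' (r%:E - f `|y|%R)%E (fun t => g (tcons x t))).

Let qE x y : J phi' (r%:E - f `|y|%R)%E (fun t => g (tcons x t)) = (q x y)%:E.
Proof. by rewrite /q; apply: (weighted_integral_fin wV ydrop (fin y) _ (mgx x)). Qed.

Let q0 x y : 0 <= q x y.
Proof. by rewrite -lee_fin -qE; exact: weighted_integral_ge0. Qed.

Let p0 x : 0 <= p x. Proof. exact: profile_ge0. Qed.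

Let mq : measurable_fun setT (fun z : R * R => q z.1 z.2).
Proof.
pose RR := measurableTypeR R.
pose F (u : (RR * RR) * m.-tuple R) :=
  (g (tcons u.1.1 u.2) * eweight V (r%:E - f `|u.1.2|%R - consumption phi' u.2)%E)%:E.
have mF : measurable_fun setT F.
  apply/measurable_EFinP; apply: measurable_funM.
    apply: (measurableT_comp mg).
    apply: (@measurable_cons _ _ ((RR * RR) * m.-tuple R)%type RR (fun u => u.1.1) m (fun u => u.2)).
      exact: (measurableT_comp (@measurable_fst _ _ RR RR) (@measurable_fst _ _ (RR * RR)%type (m.-tuple R))).
    exact: (@measurable_snd _ _ (RR * RR)%type (m.-tuple R)).
  apply: measurableT_comp; first exact: measurable_eweight.
  apply: emeasurable_funB.
    apply: emeasurable_funB => //.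
    apply: (measurableT_comp (measurable_young_norm yf)).
    exact: (measurableT_comp (@measurable_snd _ _ RR RR) (@measurable_fst _ _ (RR * RR)%type (m.-tuple R))).
  by apply: (measurableT_comp (measurable_consumption ydrop)).
have F0 u : (0 <= F u)%E by rewrite lee_fin mulr_ge0// eweight_ge0.
have := @measurable_fun_fubini_tonelli_F _ _ (RR * RR)%type _ R (@lebesgue_tuple R m) F mF F0.
move=> /(measurableT_comp (@fine_measurable R setT measurableT)).
exact.
Qed.

Let mq2 d (T : measurableType d) (u v : T -> R) : measurable_fun setT u ->
  measurable_fun setT v -> measurable_fun setT (fun z => q (u z) (v z)).
Proof.
move=> mu' mv; apply: (measurableT_comp (f := fun z : R * R => q z.1 z.2) mq (g := fun z => (u z, v z))).
exact: measurable_fun_pair.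
Qed.

(* Symmetrising in the first coordinate reduces the comparison with an
   independent copy to the monotonicity of weighted means. *)
Lemma decouple_first : abs_supermodular g ->
  (J phi r%:E g * (total_mass V phi r)%:E <=
   \int[mu]_x ((p x)%:E * weighted_integral V1 phi' r%:E (fun t => g (tcons x t))))%E.
Proof.
move=> sg.
have mp : measurable_fun setT p by exact: measurable_profile.
have E1 : (J phi r%:E g * (total_mass V phi r)%:E = \int[mu]_x \int[mu]_y (q x x * p y)%:E)%E.
  rewrite weighted_integral_cons//; under eq_integral do rewrite qE.
  rewrite muleC /= -lebesgue_integralZ ?mass_ge0//.
  - apply: eq_integral => x _; rewrite lebesgue_integralZ// massE//.
    by rewrite EFinM muleC.
  - exact: mq2.
have E2 : (\int[mu]_x ((p x)%:E * weighted_integral V1 phi' r%:E (fun t => g (tcons x t))) = \int[mu]_x \int[mu]_y (p x * q x y)%:E)%E.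
  apply: eq_integral => x _; rewrite lebesgue_integralZ//.
    congr (_ * _)%E.
    rewrite -(@weighted_integral_marginal r _ (fun t => g (tcons x [tuple of behead t])))//.
    + rewrite weighted_integral_cons//.
        apply: eq_integral => y _; rewrite -qE; congr (J _ _ _).
        by apply/funext => t; congr (g (tcons x _)); exact: val_inj.
      by apply: (measurableT_comp (mgx x)); exact: measurable_behead.
    + by apply: (measurableT_comp (mgx x)); exact: measurable_behead.
    + by move=> y t; congr (g (tcons x _)); exact: val_inj.
  exact: mq2.
rewrite E1 E2; apply: symmetrized_integral_le.
- by move=> x y; rewrite mulr_ge0.
- by move=> x y; rewrite mulr_ge0.
- apply: measurable_funM.
    exact: mq2.
  exact: (measurableT_comp mp).
- apply: measurable_funM => //; exact: (measurableT_comp mp).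
(* Rearranged, the goal is [p x * (q y y - q x y) <= p y * (q y x - q x x)]: the mean of
   [g (y, .) - g (x, .)] is no larger at the level left by [y] than at the one left by [x]. *)
move=> x y; wlog xy : x y / `|x| <= `|y|.
  by move=> H; have [xy|/ltW yx] := leP `|x| `|y|; [exact: H|rewrite addrC [leRHS]addrC; exact: H].
(* The constant [C] makes the increment nonnegative; it contributes [C * p z] to the integral and
   cancels in the comparison. Supermodularity makes [D] nondecreasing. *)
pose D t := g (tcons y t) - g (tcons x t) + C.
have C0 : 0 <= C by have /andP[] := gC (tcons 0 [tuple of nseq m 0]); exact: le_trans.
have DC t : 0 <= D t <= C + C.
  by have := gC (tcons y t); have := gC (tcons x t); rewrite /D => /andP[? ?] /andP[? ?]; lra.
have mD : measurable_fun setT D.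
  by apply: measurable_funD => //; exact: measurable_funB.
have iD : abs_nondecreasing D.
  move=> s t st; rewrite /D lerD2r lerBrDr addrAC lerBlDr.
  rewrite [leRHS]addrC; apply: sg => i; case: (unliftP ord0 i) => [j|] ->; rewrite ?tnth_tconsS ?tnth_tcons0.
  - by rewrite min_l.
  - by rewrite min_r.
  - by rewrite max_r.
  - by rewrite max_l.
(* The integral is computed by adding back [q x z], since additivity is available for nonnegative
   functions. *)
have JD z : J phi' (r%:E - f `|z|%R)%E D = (q y z - q x z + C * p z)%:E.
  have : (J phi' (r%:E - f `|z|%R)%E D + (q x z)%:E = (q y z + C * p z)%:E)%E.
    rewrite -qE EFinD -qE EFinM -[(p z)%:E](weighted_integral1 wV ydrop (fin z)).
    rewrite -weighted_integralZ// -!weighted_integralD//.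
    + by congr (J _ _ _); apply/funext => t; rewrite /D mulr1; ring.
    + by move=> t; rewrite mulr1.
    + by apply: measurable_funM; exact: measurable_cst.
    + by move=> t; case/andP: (DC t).
  rewrite (weighted_integral_fin wV ydrop (fin z) DC mD) -EFinD => -[E].
  by congr (_%:E); lra.
have [fyE|fyN] := eqVneq (f `|y|) +oo%E.
  have z0 : p y = 0 by rewrite /profile fyE.
  have qz x' : q x' y = 0.
    apply: EFin_inj; rewrite -qE fyE; apply/eqP; rewrite eq_le weighted_integral_ge0// andbT.
    by apply: le_trans (weighted_integral_bounded wV ydrop _ (fun t => gC (tcons x' t)) (mgx x')) _ => //=; rewrite mulr0.
  by rewrite z0 !qz !mulr0 !mul0r addr0.
have fxy := young_nondecreasing yf (normr_ge0 x) xy.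
have fx0 := young_ge0 yf (normr_ge0 x).
have fy0 := young_ge0 yf (normr_ge0 y).
case fyE : (f `|y|) fyN fxy fy0 => [b| |]// _ fxy fy0.
case fxE : (f `|x|) fxy fx0 => [a| |]// ab fx0.
have rr : r - b <= r - a by rewrite lerD2l lerN2.
have := weighted_mean_homo wV lc ydrop DC mD iD rr.
have px : p x = Vm (r - a) by rewrite /profile fxE.
have py : p y = Vm (r - b) by rewrite /profile fyE.
have -> : (r - b)%:E = (r%:E - f `|y|%R)%E by rewrite fyE.
have -> : (r - a)%:E = (r%:E - f `|x|%R)%E by rewrite fxE.
rewrite !JD -px -py -!EFinM lee_fin; nra.
Qed.

Lemma integral_first_fin t : (\int[mu]_x (p x * g (tcons x t))%:E)%E =
  (fine (\int[mu]_x (p x * g (tcons x t))%:E)%E)%:E.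
Proof.
rewrite fineK// ge0_fin_numE; last first.
  by apply: integral_ge0 => x _; rewrite lee_fin mulr_ge0.
have mgt : measurable_fun setT (fun x => g (tcons x t)).
  by apply: measurableT_comp => //; exact: measurable_tcons_l.
under eq_integral do rewrite mulrC.
apply: le_lt_trans (ge0_integral_le_profile wVm yf r (fun x => gC (tcons x t)) mgt) _.
by rewrite massE// -EFinM ltry.
Qed.

Lemma integral_first_coordinate :
  (\int[mu]_x ((p x)%:E * weighted_integral V1 phi' r%:E (fun t => g (tcons x t))) =
   weighted_integral V1 phi' r%:E (fun t => fine (\int[mu]_x (p x * g (tcons x t))%:E)))%E.
Proof.
have mp : measurable_fun setT p by exact: measurable_profile.
pose w t := eweight V1 (r%:E - consumption phi' t)%E.
have w0 t : 0 <= w t by exact: eweight_ge0.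
have mw : measurable_fun setT w by exact: measurable_weight.
(* [g] times the decoupled density: [p] for the first coordinate, the weight [V1] for the others,
   with no interaction. The claim is Fubini for [F]. *)
pose F (t : m.+1.-tuple R) := p (tnth t ord0) * g t * w [tuple of behead t].
have FE x t : F (tuple_cons (x, t)) = p x * g (tcons x t) * w t.
  by rewrite /F /=; congr (_ * w _); exact: val_inj.
have F0 t : 0 <= F t by rewrite !mulr_ge0.
have mF : measurable_fun setT F.
  apply: measurable_funM.
    apply: measurable_funM => //; apply: (measurableT_comp mp); exact: measurable_tnth.
  by apply: (measurableT_comp mw); exact: measurable_behead.
transitivity (\int[@lebesgue_tuple R m.+1]_t (F t)%:E)%E.
  rewrite lebesgue_tuple_fubini1//; apply: eq_integral => x _.
  rewrite /weighted_integral -ge0_integralZ//.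
  - by apply: eq_integral => t _; rewrite FE mulrA.
  - by move=> t; apply: mulr_ge0 => //; exact: w0.
  - by apply: measurable_funM; [exact: mgx|exact: mw].
rewrite lebesgue_tuple_fubini2//; apply: eq_integral => t _.
under eq_integral do rewrite FE mulrC.
rewrite lebesgue_integralZ//.
- by rewrite integral_first_fin -EFinM mulrC.
- by move=> x; rewrite mulr_ge0.
- apply: measurable_funM => //.
  by apply: measurableT_comp => //; exact: measurable_tcons_l.
Qed.

Lemma measurable_integral_first :
  measurable_fun setT (fun t => fine (\int[mu]_x (p x * g (tcons x t))%:E)%E).
Proof.
have mp : measurable_fun setT p by exact: measurable_profile.
apply: (measurableT_comp (f := fine)); first exact: fine_measurable.
apply: (eq_measurable_fun (fun t => \int[mu]_x ((fun u => p (tnth u ord0) * g u) (tuple_cons (x, t)))%:E)%E) => //.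
apply: (@measurable_lebesgue_tuple_fubini2 R m (fun u => p (tnth u ord0) * g u)) => [t|].
  by rewrite mulr_ge0.
apply: measurable_funM => //; apply: (measurableT_comp mp); exact: measurable_tnth.
Qed.

End first_coordinate.
End supermodular.

(** * Independent families *)

Section independence.
Context (R : realType) d (T : measurableType d) (Q : probability T R).

Definition joint m (Y : 'I_m -> T -> R) (w : T) : m.-tuple R := [tuple Y i w | i < m].

(** Testing the full index set covers subfamilies, by taking [A i = setT] at the omitted indices. *)
Definition product_rule m (Y : 'I_m -> T -> R) :=
  forall A : 'I_m -> set R, (forall i, measurable (A i)) ->
    Q [set w | forall i, A i (Y i w)] = (\prod_(i < m) Q (Y i @^-1` A i))%E.

Definition drop_rv m (Y : 'I_m.+1 -> T -> R) : 'I_m -> T -> R := fun i => Y (lift ord0 i).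

Lemma measurable_joint m (Y : 'I_m -> T -> R) :
  (forall i, measurable_fun setT (Y i)) -> measurable_fun setT (joint Y).
Proof.
move=> mY; apply/measurable_fun_tnthP => i.
by apply: eq_measurable_fun (mY i) => w _ /=; rewrite tnth_mktuple.
Qed.

Lemma joint_cons m (Y : 'I_m.+1 -> T -> R) w :
  joint Y w = tcons (Y ord0 w) (joint (drop_rv Y) w).
Proof.
apply: eq_from_tnth => i; rewrite tnth_mktuple.
by case: (unliftP ord0 i) => [j|] ->; rewrite ?tnth_tconsS ?tnth_tcons0 ?tnth_mktuple.
Qed.

Definition box m (A : 'I_m -> set R) : set (m.-tuple R) :=
  [set t | forall i, A i (tnth t i)].

Definition boxes m : set (set (m.-tuple R)) :=
  [set B | exists2 A : 'I_m -> set R, (forall i, measurable (A i)) & B = box A].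

Lemma measurable_box m (A : 'I_m -> set R) : (forall i, measurable (A i)) ->
  measurable (box A).
Proof.
move=> mA; have -> : box A = \bigcap_(i in setT) ((@tnth m R ^~ i) @^-1` A i).
  by apply/seteqP; split => t /= H i; [move=> _; exact: H|exact: (H i I)].
apply: fin_bigcap_measurable => [|i _]; first exact: finite_finset.
by rewrite -[X in measurable X]setTI; exact: measurable_tnth.
Qed.

(** The coordinate maps generate the tuple structure, and the preimage of a set under one of them is
    a box with [setT] elsewhere. Boxes being stable under intersection, they determine finite
    measures. *)
Lemma measurable_boxes m : @measurable _ (m.-tuple R) = <<s @boxes m >>.
Proof.
apply/seteqP; split; last first.
  apply: smallest_sub; first exact: sigma_algebra_measurable.
  by move=> _ [A mA ->]; exact: measurable_box.
pose idT := fun t : g_sigma_algebraType (@boxes m) => (t : m.-tuple R).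
have mid : measurable_fun setT idT.
  apply/measurable_fun_tnthP => i _ A mA; rewrite setTI.
  apply: sub_sigma_algebra; exists (fun j => if j == i then A else setT).
    by move=> j; case: ifP.
  apply/seteqP; split => t /= H.
    by move=> j; case: eqVneq => // ->.
  by have := H i; rewrite eqxx.
by move=> B mB; have := mid measurableT B mB; rewrite setTI.
Qed.

Lemma product_rule_drop m (Y : 'I_m.+1 -> T -> R) (A : set R) (B : 'I_m -> set R) :
  product_rule Y -> measurable A -> (forall i, measurable (B i)) ->
  Q (Y ord0 @^-1` A `&` [set w | forall i, B i (drop_rv Y i w)]) =
  (Q (Y ord0 @^-1` A) * \prod_(i < m) Q (drop_rv Y i @^-1` B i))%E.
Proof.
move=> iY mA mB.
pose AB i := if unlift ord0 i is Some j then B j else A.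
have mAB i : measurable (AB i) by rewrite /AB; case: unlift.
have := iY AB mAB; rewrite big_ord_recl {2}/AB unlift_none.
under eq_bigr do rewrite /AB liftK; move=> <-.
congr (Q _); apply/seteqP; split => w /=.
  move=> [HA HB] i; rewrite /AB; case: (unliftP ord0 i) => [j|] ->.
    exact: HB.
  exact: HA.
move=> H; split.
  by have := H ord0; rewrite /AB unlift_none.
by move=> i; have := H (lift ord0 i); rewrite /AB liftK.
Qed.

Lemma product_ruleS m (Y : 'I_m.+1 -> T -> R) : product_rule Y ->
  product_rule (drop_rv Y).
Proof.
move=> iY B mB; have := product_rule_drop iY measurableT mB.
by rewrite preimage_setT setTI probability_setT mul1e.
Qed.

Context (m : nat) (Y : 'I_m.+1 -> T -> R).
Hypotheses (mY : forall i, measurable_fun setT (Y i)) (iY : product_rule Y).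

Let mYd i : measurable_fun setT (drop_rv Y i). Proof. exact: mY. Qed.

Let mjoint : measurable_fun setT (joint (drop_rv Y)).
Proof. exact: measurable_joint. Qed.

(** For fixed [A] both sides are finite measures in [B]; they agree on boxes by [product_rule],
    hence everywhere. *)
Lemma independent_rectangle (A : set R) (B : set (m.-tuple R)) :
  measurable A -> measurable B ->
  Q (Y ord0 @^-1` A `&` joint (drop_rv Y) @^-1` B) =
  (Q (Y ord0 @^-1` A) * Q (joint (drop_rv Y) @^-1` B))%E.
Proof.
move=> mA mB; set A' := Y ord0 @^-1` A.
have mA' : measurable A' by rewrite /A' -[X in measurable X]setTI; exact: mY.
have [m1 m1E _] := measure_image (mrestr Q mA') mjoint.
have k0 : 0 <= fine (Q A') by exact: fine_ge0.
have [n2 n2E _] := measure_image Q mjoint.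
pose m2 : {measure set (m.-tuple R) -> \bar R} := mscale (NngNum k0) n2.
have m2E C : m2 C = (Q A' * Q (joint (drop_rv Y) @^-1` C))%E.
  by rewrite /m2 /= /mscale /= n2E fineK ?fin_num_measure.
have m1E' C : m1 C = Q (A' `&` joint (drop_rv Y) @^-1` C).
  by rewrite m1E /mrestr setIC.
rewrite -m1E' -m2E.
apply: (@measure_unique _ R (m.-tuple R) (@boxes m) (fun=> setT) _ _ _ _ m1 m2) => //.
- exact: measurable_boxes.
- move=> _ _ [A1 mA1 ->] [A2 mA2 ->]; exists (fun i => A1 i `&` A2 i).
    by move=> i; exact: measurableI.
  apply/seteqP; split => t /=.
    by move=> [H1 H2] i; split; [exact: H1|exact: H2].
  by move=> H; split => i; case: (H i).
- move=> _; exists (fun=> setT) => //.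
  by apply/seteqP; split.
- by rewrite bigcup_const//; exists 0%N.
- move=> _ [C mC ->]; rewrite m1E' m2E.
  have E : joint (drop_rv Y) @^-1` box C = [set w | forall i, C i (drop_rv Y i w)].
    by apply/seteqP; split => w /= H i; have := H i; rewrite tnth_mktuple.
  rewrite E product_rule_drop//; congr (_ * _)%E.
  by rewrite (product_ruleS iY).
- move=> k; rewrite m1E'; apply: (@le_lt_trans _ _ 1%E); last exact: ltry.
  by apply: probability_le1; apply: measurableI => //; rewrite preimage_setT.
Qed.

(** The law of the first variable paired with the others is a product measure, since it factors on
    rectangles; Tonelli then gives the iterated integral. *)
Lemma integral_joint_cons (H : m.+1.-tuple R -> R) :
  (forall t, 0 <= H t) -> measurable_fun setT H ->
  (\int[Q]_w (H (joint Y w))%:E =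
   \int[Q]_w \int[Q]_w' (H (tcons (Y ord0 w') (joint (drop_rv Y) w)))%:E)%E.
Proof.
move=> H0 mH.
pose RR := measurableTypeR R.
pose Y0m := isMeasurableFun.Build _ _ T RR (Y ord0) (mY ord0).
pose Y0 : {RV Q >-> RR} := HB.pack (Y ord0 : T -> RR) Y0m.
pose Jm := isMeasurableFun.Build _ _ T (m.-tuple R) (joint (drop_rv Y)) mjoint.
pose J' : {RV Q >-> m.-tuple R} := HB.pack (joint (drop_rv Y)) Jm.
pose n0 : probability RR R := distribution Q Y0.
pose n1 : probability (m.-tuple R) R := distribution Q J'.
pose g w : RR * m.-tuple R := (Y ord0 w, joint (drop_rv Y) w).
have mg : measurable_fun setT g by apply: measurable_fun_pair => //; exact: mY.
have [n nE In] := measure_image Q mg.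
pose F (p : RR * m.-tuple R) := H (tcons p.1 p.2).
have mF : measurable_fun setT F by apply: (measurableT_comp mH); exact: measurable_tcons.
have mFE : measurable_fun setT (EFin \o F) by exact/measurable_EFinP.
have FE0 p : (0 <= (EFin \o F) p)%E by rewrite lee_fin; exact: H0.
transitivity (\int[n]_p (F p)%:E)%E.
  by rewrite In//; apply: eq_integral => w _; rewrite joint_cons.
transitivity (\int[(n0 \x n1)%E]_p (F p)%:E)%E.
  apply: eq_measure_integral => C mC _; apply/esym.
  apply: product_measure_unique => // A B mA mB; rewrite nE.
  exact: independent_rectangle.
transitivity (\int[n1]_t \int[n0]_x (F (x, t))%:E)%E.
  exact: (@fubini_tonelli2 _ _ RR (m.-tuple R) R n0 n1 _ mFE FE0).
have mG : measurable_fun setT (fun t => \int[n0]_x (F (x, t))%:E)%E.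
  exact: (@measurable_fun_fubini_tonelli_G _ _ RR (m.-tuple R) R n0 _ mFE FE0).
have G0 t : (0 <= \int[n0]_x (F (x, t))%:E)%E by apply: integral_ge0 => x _; exact: FE0.
rewrite (ge0_integral_distribution J' mG G0); apply: eq_integral => w _ /=.
have mFt t : measurable_fun setT (fun x : RR => (F (x, t))%:E).
  apply/measurable_EFinP; apply: (measurableT_comp mH); exact: measurable_tcons_l.
by rewrite (ge0_integral_distribution Y0 (mFt _))// => x; exact: FE0.
Qed.

End independence.

(** * Comparison of weighted laws with independent coordinates *)

Section comparison.
Context (R : realType) d (T : measurableType d) (Q : probability T R).
Local Notation mu := (@lebesgue_measure R).

(* [Y] has the one-dimensional marginals of the law with density proportional to
   [V (r - consumption phi t)]. *)
Definition has_marginals V m (phi : 'I_m -> R -> \bar R) (r : R) (Y : 'I_m -> T -> R) :=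
  forall i (A : set R), measurable A ->
    (Q (Y i @^-1` A) * (total_mass V phi r)%:E =
     weighted_integral V phi r%:E (fun t => \1_A (tnth t i)))%E.

(** The marginal hypothesis, with the other coordinates integrated out, says that [Y ord0] has
    density [p / Z]. *)
Lemma integral_first_marginal V m (phi : 'I_m.+1 -> R -> \bar R) r Y (H : R -> R) :
  slack_weight V -> all_young phi -> (forall i, measurable_fun setT (Y i)) ->
  0 < total_mass V phi r -> has_marginals V phi r Y ->
  (forall x, 0 <= H x) -> measurable_fun setT H ->
  ((total_mass V phi r)%:E * \int[Q]_w (H (Y ord0 w))%:E =
   \int[mu]_x (profile (total_mass V (drop_first phi)) (phi ord0) r x * H x)%:E)%E.
Proof.
move=> wV yphi mY; set Z := total_mass V phi r => Z0 hY H0 mH.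
have ydrop := all_young_drop yphi.
set p := profile _ _ r.
have wVm : slack_weight (total_mass V (drop_first phi)) by exact: slack_weight_total.
have p0 x : 0 <= p x by exact: profile_ge0.
have mp : measurable_fun setT p by apply: measurable_profile => //; exact: yphi.
pose RR := measurableTypeR R.
have [n nE In] := @measure_image _ _ T RR R Q (Y ord0) (mY ord0).
have Zi : 0 <= Z^-1 by rewrite invr_ge0 ltW.
have w0 x : 0 <= Z^-1 * p x by rewrite mulr_ge0.
have mw : measurable_fun setT (fun x => Z^-1 * p x) by apply: measurable_funM.
have nA (A : set RR) : measurable A -> n A = (\int[mu]_x (\1_A x * (Z^-1 * p x))%:E)%E.
  move=> mA; have mI : measurable_fun setT (\1_A : R -> R) by exact: measurable_indic.
  under eq_integral do rewrite mulrCA.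
  rewrite lebesgue_integralZ//; last 2 first.
  - by move=> x; rewrite mulr_ge0.
  - exact: measurable_funM.
  have -> : (\int[mu]_x (\1_A x * p x)%:E = weighted_integral V phi r%:E (fun t => \1_A (tnth t ord0)))%E.
    rewrite weighted_integral_cons//; last first.
      by apply: (measurableT_comp mI); exact: measurable_tnth.
    apply: eq_integral => x _.
    have fx : (r%:E - phi ord0 `|x|%R)%E != +oo%E.
      by apply: slack_neqy; apply: young_ge0 => //; exact: yphi.
    rewrite EFinM -(weighted_integral1 wV ydrop fx) -weighted_integralZ//.
    by congr (weighted_integral _ _ _); apply/funext => t; rewrite mulr1.
  by rewrite -hY// nE muleCA -EFinM mulVf ?mule1// gt_eqF.
have -> : (\int[Q]_w (H (Y ord0 w))%:E = \int[n]_x (H x)%:E)%E.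
  by rewrite (In H H0 mH).
rewrite (@integral_density _ RR R mu n (fun x => Z^-1 * p x) w0 mw nA H H0 mH).
rewrite -lebesgue_integralZ//.
- apply: eq_integral => x _; congr (_%:E).
  by field; rewrite gt_eqF.
- exact: ltW.
- by move=> x; rewrite mulr_ge0.
- exact: measurable_funM.
Qed.

(** Induction over all weights [V]: [decouple_first] makes the first coordinate independent,
    averaging over it leaves a supermodular function of the others, and these have weight
    [mass V (phi ord0)], again log-concave. *)
Lemma supermodular_comparison m V (phi : 'I_m -> R -> \bar R) (g : m.-tuple R -> R)
    (C r : R) (Y : 'I_m -> T -> R) :
  slack_weight V -> log_concave V -> all_young phi ->
  (forall t, 0 <= g t <= C) -> measurable_fun setT g -> abs_supermodular g ->
  (forall i, measurable_fun setT (Y i)) -> product_rule Q Y ->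
  0 < total_mass V phi r -> has_marginals V phi r Y ->
  (weighted_integral V phi r%:E g <=
   (total_mass V phi r)%:E * \int[Q]_w (g (joint Y w))%:E)%E.
Proof.
elim: m V phi g Y => [|m IH] V phi g Y wV lc yphi gC mg sg mY iY Z0 hY.
  have -> : (\int[Q]_w (g (joint Y w))%:E = (g [tuple])%:E)%E.
    transitivity (\int[Q]_w cst (g [tuple])%:E w)%E.
      by apply: eq_integral => w _; congr (g _)%:E; exact: tuple0.
    by rewrite integral_cst// -[RHS]mule1; congr (_ * _)%E; exact: probability_setT.
  by rewrite weighted_integral0//= -EFinM mulrC.
have ydrop := all_young_drop yphi.
have yf := yphi ord0.
set f := phi ord0 in yf; set phi' := drop_first phi in ydrop.
have wVm : slack_weight (total_mass V phi') by exact: slack_weight_total.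
set Z := total_mass V phi r in Z0 *.
set V1 := mass V f; set p := profile (total_mass V phi') f r.
have wV1 : slack_weight V1 by exact: slack_weight_mass.
have lc1 : log_concave V1 by exact: log_concave_mass.
have Z1 : total_mass V1 phi' r = Z by exact: total_mass_marginal.
have g0 t : 0 <= g t by case/andP: (gC t).
have p0 x : 0 <= p x by exact: profile_ge0.
have mp : measurable_fun setT p by exact: measurable_profile.
have mgt t : measurable_fun setT (fun x => g (tcons x t)).
  by apply: measurableT_comp => //; exact: measurable_tcons_l.
have mpg t : measurable_fun setT (fun x => p x * g (tcons x t)) by exact: measurable_funM.
pose gm t := fine (\int[mu]_x (p x * g (tcons x t))%:E)%E.
have gmE t : (\int[mu]_x (p x * g (tcons x t))%:E)%E = (gm t)%:E.
  exact: (integral_first_fin wV yphi r gC mg).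
have gm0 t : 0 <= gm t.
  by rewrite -lee_fin -gmE; apply: integral_ge0 => x _; rewrite lee_fin mulr_ge0.
have gmC t : gm t <= C * Z.
  rewrite -lee_fin -gmE; under eq_integral do rewrite mulrC.
  apply: le_trans (ge0_integral_le_profile wVm yf r (fun x => gC (tcons x t)) (mgt t)) _.
  by rewrite massE// EFinM.
have mgm : measurable_fun setT gm by exact: (measurable_integral_first wV yphi r gC mg).
(* [gb] averages [g] over the law of the first coordinate; dividing by [Z] keeps the bound [C]. *)
pose gb t := Z^-1 * gm t.
have Zi : 0 <= Z^-1 by rewrite invr_ge0 ltW.
have gb0 t : 0 <= gb t by rewrite mulr_ge0.
have gbC t : 0 <= gb t <= C by rewrite gb0/= /gb ler_pdivrMl// mulrC.
have mgb : measurable_fun setT gb by apply: measurable_funM.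
have sgb : abs_supermodular gb.
  move=> a b lo hi loE hiE; rewrite /gb -!mulrDr; apply: ler_wpM2l => //.
  have pg0 t x : 0 <= p x * g (tcons x t) by rewrite mulr_ge0.
  rewrite -lee_fin !EFinD -!gmE -!lebesgue_integralD//.
  apply: le_lebesgue_integral => [x|||x].
  - exact: addr_ge0.
  - exact: measurable_funD.
  - exact: measurable_funD.
  rewrite -!mulrDr; apply: ler_wpM2l => //.
  exact: (@abs_supermodular_tcons _ _ g x sg a b lo hi).
have hY1 : has_marginals V1 phi' r (drop_rv Y).
  move=> i A mA; rewrite Z1 hY//.
  apply: (@weighted_integral_marginal R V wV m phi yphi r (fun t => \1_A (tnth t i))) => //.
    by apply: measurableT_comp; [exact: measurable_indic|exact: measurable_tnth].
  by move=> x t; rewrite tnth_tconsS.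
have := IH V1 phi' gb (drop_rv Y) wV1 lc1 ydrop gbC mgb sgb (fun i => mY _) (product_ruleS iY).
rewrite Z1 => /(_ Z0 hY1) HI.
(* [decouple_first] carries a second factor [Z] from the independent copy; it cancels since
   [0 < Z]. *)
suff H : (weighted_integral V phi r%:E g * Z%:E <= Z%:E * \int[Q]_w (g (joint Y w))%:E * Z%:E)%E.
  by move: H; rewrite lee_pmul2r ?lte_fin.
have D := @decouple_first R V wV m phi yphi lc r C g gC mg sg.
apply: (le_trans D).
rewrite (integral_first_coordinate wV yphi r gC mg).
have -> : weighted_integral V1 phi' r%:E gm = (Z%:E * weighted_integral V1 phi' r%:E gb)%E.
  rewrite -weighted_integralZ//; last exact: ltW.
  congr (weighted_integral _ _ _); apply/funext => t.
  by rewrite /gb mulrA divff ?mul1r// gt_eqF.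
rewrite muleC; apply: lee_wpmul2r; first by rewrite lee_fin ltW.
apply: (le_trans HI); rewrite le_eqVlt; apply/orP; left; apply/eqP; congr (_ * _)%E.
rewrite (integral_joint_cons mY iY)//; apply: eq_integral => w _.
have := @integral_first_marginal V m phi r Y (fun x => g (tcons x (joint (drop_rv Y) w))) wV yphi mY Z0 hY (fun x => g0 _) (mgt _).
by rewrite gmE => E; rewrite /gb EFinM -E muleA -EFinM mulVf ?mul1e ?gt_eqF.
Qed.

End comparison.

(** * Convex functions and maxima of partial sums *)

Section convex.
Context (R : realType) (f : R -> R).
Hypothesis hf : convex_function (setT : set (convex_lmodType R^o)) f.

Lemma convex_function_le (t x y : R) : 0 <= t <= 1 ->
  f (t * x + (1 - t) * y) <= t * f x + (1 - t) * f y.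
Proof.
move=> /andP[t0 t1]; have := hf (Itv01 t0 t1) (in_setT x) (in_setT y).
rewrite !convRE /=.
by move=> H; exact: H.
Qed.

(** The inner points [b] and [c] are combinations of [a] and [e] with exchanged weights, so the two
    convexity inequalities add up. *)
Lemma convex_function_spread (a b c e : R) : a <= b -> a <= c -> b <= e -> c <= e ->
  b + c = a + e -> f b + f c <= f a + f e.
Proof.
move=> ab ac be ce bcae.
have [ae|ae] := eqVneq a e.
  have bE : b = a by lra.
  have cE : c = a by lra.
  by rewrite bE cE -ae.
have l0 : 0 < e - a by rewrite subr_gt0 lt_neqAle ae (le_trans ab).
pose t := (e - b) / (e - a).
have t01 : 0 <= t <= 1.
  apply/andP; split; first by apply: divr_ge0; lra.
  by rewrite ler_pdivrMr// mul1r; lra.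
have t01' : 0 <= 1 - t <= 1 by lra.
have := convex_function_le a e t01; have := convex_function_le a e t01'.
have -> : t * a + (1 - t) * e = b by rewrite /t; field; rewrite gt_eqF.
have -> : (1 - t) * a + (1 - (1 - t)) * e = c.
  have -> : c = a + e - b by lra.
  by rewrite /t; field; rewrite gt_eqF.
lra.
Qed.

(** The chord over [[-L, L]] bounds [f] above by [K]; the lower bound follows from
    [2 * f 0 <= f x + f (- x)]. *)
Lemma convex_function_bounded (L : R) : exists M : R, forall x, `|x| <= L -> `|f x| <= M.
Proof.
pose K := Num.max `|f L| `|f (- L)|.
exists (K + 2 * `|f 0|) => x; rewrite ler_norml => /andP[Lx xL].
have fL : `|f L| <= K by rewrite le_max lexx.
have fL' : `|f (- L)| <= K by rewrite le_max lexx orbT.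
have up y : - L <= y -> y <= L -> f y <= K.
  move=> Ly yL; have [L0|L0] := eqVneq (L - - L) 0.
    have -> : y = L by lra.
    by apply: le_trans fL; exact: ler_norm.
  have l0 : 0 < L - - L by rewrite lt_neqAle eq_sym L0; lra.
  pose t := (y - - L) / (L - - L).
  have t01 : 0 <= t <= 1.
    by rewrite divr_ge0 ?subr_ge0 ?(ltW l0)//= ?ler_pdivrMr// ?mul1r; lra.
  have := convex_function_le L (- L) t01.
  have -> : t * L + (1 - t) * - L = y by rewrite /t; field; rewrite gt_eqF//; lra.
  move/le_trans; apply.
  have K1 : f L <= K by apply: le_trans fL; exact: ler_norm.
  have K2 : f (- L) <= K by apply: le_trans fL'; exact: ler_norm.
  have /andP[? ?] := t01; nra.
have h12 : 0 <= (2^-1 : R) <= 1 by lra.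
have := convex_function_le x (- x) h12.
have -> : 2^-1 * x + (1 - 2^-1) * - x = 0 by lra.
have u1 := up x Lx xL; have u2 : f (- x) <= K by apply: up; lra.
have n1 : f 0 <= `|f 0| by exact: ler_norm.
have n2 : - `|f 0| <= f 0 by rewrite lerNl -normrN; exact: ler_norm.
by move=> ?; rewrite ler_norml; lra.
Qed.

(** Sublevel sets of a convex function are intervals. *)
Lemma convex_function_measurable : measurable_fun setT f.
Proof.
apply: (measurability (@measurable_realfun.RGenOInfty.G R)).
  exact: measurable_realfun.RGenOInfty.measurableE.
move=> _ [_ [r ->] <-]; rewrite setTI.
have -> : f @^-1` `]r, +oo[%classic = ~` [set x | f x <= r].
  by apply/seteqP; split => x /=; rewrite in_itv/= andbT ltNge => /negP.
apply: measurableC; apply: is_interval_measurable => x y /= fx fy z /andP[xz zy].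
have [xy|xy] := eqVneq x y.
  by have -> : z = x by lra.
have l0 : 0 < y - x by rewrite subr_gt0 lt_neqAle xy (le_trans xz).
pose t := (y - z) / (y - x).
have t01 : 0 <= t <= 1.
  apply/andP; split; first by apply: divr_ge0; lra.
  by rewrite ler_pdivrMr// mul1r; lra.
have := convex_function_le x y t01.
have -> : t * x + (1 - t) * y = z by rewrite /t; field; rewrite gt_eqF.
have /andP[? ?] := t01; move/le_trans; apply; nra.
Qed.

End convex.

Section max_partial_sum.
Context (R : realType) (n : nat).
Implicit Types (x p q : 'I_n.+1 -> R).

Let S x (k : 'I_n.+1) : R := \sum_(i < n.+1 | (i <= k)%N) x i.

Lemma partial_sum_le_max x k : S x k <= max_partial_sum x.
Proof. exact: le_bigmax. Qed.

Lemma max_partial_sum_attained x : exists k, max_partial_sum x = S x k.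
Proof.
rewrite /max_partial_sum; elim/big_ind : _ => [|a b [i ->] [j ->]|i _].
- by exists ord0.
- by have [ij|ji] := leP (\sum_(i0 < n.+1 | (i0 <= i)%N) x i0) (\sum_(i0 < n.+1 | (i0 <= j)%N) x i0); [exists j|exists i].
- by exists i.
Qed.

Lemma max_partial_sum_homo p q : (forall i, p i <= q i) ->
  max_partial_sum p <= max_partial_sum q.
Proof.
move=> pq; have [k ->] := max_partial_sum_attained p.
by apply: le_trans (partial_sum_le_max q k); apply: ler_sum.
Qed.

(** Let the maxima be attained at [k] for [p] and [l] for [q], with [k <= l]. Keeping [k] for the
    minima loses the sum of [hi - q] up to [k], keeping [l] for the maxima gains the same sum up to
    [l], and the terms are nonnegative. If [l < k], exchange [p] and [q]. *)
Lemma max_partial_sum_supermodular p q :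
  max_partial_sum p + max_partial_sum q <=
  max_partial_sum (fun i => Num.min (p i) (q i)) +
  max_partial_sum (fun i => Num.max (p i) (q i)).
Proof.
set lo := fun i => Num.min (p i) (q i); set hi := fun i => Num.max (p i) (q i).
have key p' q' (k l : 'I_n.+1) : (k <= l)%N ->
    (forall i, lo i + hi i = p' i + q' i) -> (forall i, q' i <= hi i) ->
    S p' k + S q' l <= S lo k + S hi l.
  move=> kl E qh.
  have -> : S p' k = S lo k + \sum_(i < n.+1 | (i <= k)%N) (hi i - q' i).
    by rewrite /S -big_split /=; apply: eq_bigr => i _; have := E i; lra.
  have -> : S hi l = S q' l + \sum_(i < n.+1 | (i <= l)%N) (hi i - q' i).
    by rewrite /S -big_split /=; apply: eq_bigr => i _; lra.
  suff : \sum_(i < n.+1 | (i <= k)%N) (hi i - q' i) <= \sum_(i < n.+1 | (i <= l)%N) (hi i - q' i) by lra.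
  rewrite [leLHS]big_mkcond [leRHS]big_mkcond /=; apply: ler_sum => i _.
  case: ifP => ik; first by rewrite (leq_trans ik kl).
  by case: ifP => // _; rewrite subr_ge0.
have E i : lo i + hi i = p i + q i.
  by rewrite /lo /hi addr_min_max.
have [k pk] := max_partial_sum_attained p; have [l ql] := max_partial_sum_attained q.
rewrite pk ql.
have [kl|/ltnW lk] := leqP k l.
  apply: (@le_trans _ _ (S lo k + S hi l)); last by apply: lerD; exact: partial_sum_le_max.
  by apply: key => // i; rewrite /hi le_max lexx orbT.
apply: (@le_trans _ _ (S lo l + S hi k)); last by apply: lerD; exact: partial_sum_le_max.
rewrite addrC; apply: key => // i; first by rewrite E addrC.
by rewrite /hi le_max lexx.
Qed.

Lemma max_partial_sum_bounded (L : R) x : (forall i, `|x i| <= L) ->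
  `|max_partial_sum x| <= n.+1%:R * L.
Proof.
move=> xL; have [k ->] := max_partial_sum_attained x.
have L0 : 0 <= L by apply: le_trans (xL ord0).
apply: le_trans (ler_norm_sum _ _ _) _.
apply: (@le_trans _ _ (\sum_(i < n.+1) L)).
  rewrite big_mkcond /=; apply: ler_sum => i _; by case: ifP.
by rewrite sumr_const card_ord mulr_natl.
Qed.

Lemma measurable_max_partial_sum d (T : measurableType d) (X : 'I_n.+1 -> T -> R) :
  (forall i, measurable_fun setT (X i)) ->
  measurable_fun setT (fun w => max_partial_sum (fun i => X i w)).
Proof.
move=> mX; rewrite /max_partial_sum.
have mS k : measurable_fun setT (fun w => S (fun i => X i w) k).
  pose G (r : seq 'I_n.+1) w := \sum_(i <- r | (i <= k)%N) X i w.
  suff mG r : measurable_fun setT (G r) by exact: mG.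
  elim: r => [|i r IH].
    have -> : G [::] = cst 0 by apply/funext => w; rewrite /G big_nil.
    exact: measurable_cst.
  have -> : G (i :: r) = fun w => if (i <= k)%N then X i w + G r w else G r w.
    by apply/funext => w; rewrite /G big_cons.
  by case: (i <= k)%N; [exact: measurable_funD|exact: IH].
pose F (r : seq 'I_n.+1) w := \big[Num.max/S (fun i => X i w) ord0]_(k <- r) S (fun i => X i w) k.
suff mF r : measurable_fun setT (F r) by exact: mF.
elim: r => [|k r IH].
  have -> : F [::] = fun w => S (fun i => X i w) ord0.
    by apply/funext => w; rewrite /F big_nil.
  exact: mS.
have -> : F (k :: r) = fun w => Num.max (S (fun i => X i w) k) (F r w).
  by apply/funext => w; rewrite /F big_cons.
exact: measurable_maxr.
Qed.

End max_partial_sum.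

(** * Orlicz balls *)

Section orlicz.
Context (R : realType).

(** The initial weight: at level 1 it turns the slack into the indicator of the Orlicz ball. *)
Definition unit_step (s : R) : R := (0 <= s)%R%:R.

Lemma slack_weight_unit_step : slack_weight unit_step.
Proof.
split=> [s|s s0|s t st]; first by rewrite /unit_step ler0n.
  by rewrite /unit_step leNgt s0.
rewrite /unit_step ler_nat; case: (leP 0 s) => // s0.
by rewrite (le_trans s0 st).
Qed.

Lemma log_concave_unit_step : log_concave unit_step.
Proof.
move=> u u' e uu' e0; rewrite /unit_step.
have [u0|u0] := leP 0 u; last by rewrite mulr0 mulr_ge0.
have -> : 0 <= u' + e by lra.
have -> : 0 <= u + e by lra.
by have -> : 0 <= u' by lra.
Qed.

Lemma orlicz_ball_weight n (phi : 'I_n -> R -> \bar R) t : all_young phi ->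
  eweight unit_step (1%:E - consumption phi t)%E = \1_(orlicz_ball phi) t.
Proof.
move=> yphi; rewrite indicE /orlicz_ball.
have -> : (t \in [set x | (\sum_(i < n) phi i `|tnth x i|%R <= 1)%E]) = (consumption phi t <= 1)%E.
  by apply/idP/idP => [/set_mem//|H]; apply/mem_set.
have := consumption_ge0 t yphi.
case: (consumption phi t) => [c| |]//= _.
by rewrite /unit_step lee_fin subr_ge0.
Qed.

Lemma measurable_orlicz_ball n (phi : 'I_n -> R -> \bar R) : all_young phi ->
  measurable (orlicz_ball phi).
Proof.
move=> yphi; rewrite -[X in measurable X]setTI.
by apply: measurable_realfun.emeasurable_fun_infty_c => //; exact: measurable_consumption.
Qed.

Lemma orlicz_ball_bounded n (phi : 'I_n -> R -> \bar R) : all_young phi ->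
  exists2 B : R, 0 <= B & forall t, orlicz_ball phi t -> forall i, `|tnth t i| <= B.
Proof.
move=> yphi.
have /choice[b Hb] i : exists B : R, 0 < B /\ forall x, B <= x -> (1%:E < phi i x)%E.
  by have [B B0 HB] := young_unbounded (yphi i) 1; exists B.
exists (\sum_i b i); first by apply: sumr_ge0 => i _; case: (Hb i) => /ltW.
move=> t Kt i; apply: (@le_trans _ _ (b i)); last first.
  by rewrite (bigD1 i)//= lerDl; apply: sumr_ge0 => j _; case: (Hb j) => /ltW.
rewrite leNgt; apply/negP => /ltW /(proj2 (Hb i)); apply/negP; rewrite -leNgt.
apply: le_trans Kt; rewrite (bigD1 i)//= leeDl//.
by apply: sume_ge0 => j _; exact: young_ge0.
Qed.

End orlicz.

Lemma expectation_subr_cst (R : realType) d (T : measurableType d) (P : probability T R)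
    (h : T -> R) (C M : R) : measurable_fun setT h -> (forall w, 0 <= h w <= C) ->
  (\int[P]_w (h w - M)%:E = \int[P]_w (h w)%:E - M%:E)%E.
Proof.
move=> mh hC.
have ih : P.-integrable setT (EFin \o h).
  apply: measurable_bounded_integrable => //.
    exact: le_lt_trans (probability_le1 _ _) (ltry _).
  exists C; split; first exact: num_real.
  move=> x Cx w _ /=; rewrite ger0_norm; last by case/andP: (hC w).
  by apply: le_trans (ltW Cx); case/andP: (hC w).
have iM : P.-integrable setT (EFin \o cst M) by exact: finite_measure_integrable_cst.
rewrite -[X in (_ - X)%E](_ : (\int[P]_w (cst M w)%:E)%E = _); last first.
  transitivity (\int[P]_w cst M%:E w)%E => //.
  by rewrite integral_cst// -[RHS]mule1; congr (_ * _)%E; exact: probability_setT.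
by rewrite -integralB_EFin.
Qed.

(** * The uniform law on the ball and its independent copy *)

Section main.
Context (R : realType) (n : nat) (phi : 'I_n.+1 -> R -> \bar R).
Hypothesis yphi : all_young phi.
Context (a : 'I_n.+1 -> R) d (T : measurableType d) (P : probability T R).
Context (X : {RV P >-> n.+1.-tuple R}).
Hypothesis hX : uniform_on (@lebesgue_tuple R n.+1) (orlicz_ball phi) X.
Context d' (T' : measurableType d') (Q : probability T' R).
Context (Y : 'I_n.+1 -> {RV Q >-> R}).
Hypothesis hYindep : mutually_independent Y.
Hypothesis hYX : forall i, same_distribution (Y i) (rv_coord X i : {RV P >-> R}).
Local Notation K := (orlicz_ball phi).
Local Notation V := (@unit_step R).
Local Notation J := (weighted_integral V phi 1%:E).
Local Notation Z := (total_mass V phi 1).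

Let wV : slack_weight V := slack_weight_unit_step R.

Let lebesgue_ball (A : set (n.+1.-tuple R)) : measurable A ->
  lebesgue_tuple (A `&` K) = J (\1_A).
Proof.
move=> mA; rewrite -[A `&` K]setIT -integral_indic//; last first.
  by apply: measurableI => //; exact: measurable_orlicz_ball.
by apply: eq_integral => t _; rewrite orlicz_ball_weight// indicI.
Qed.

Let lebesgue_ballT : lebesgue_tuple K = Z%:E.
Proof.
rewrite -[K]setTI lebesgue_ball//.
rewrite (_ : \1_setT = cst 1); last by apply/funext => t; rewrite indicT.
by rewrite weighted_integral1.
Qed.

(** The existence of [X] forces this: if the ball had measure 0, [uniform_on] would give the whole
    space probability 0. *)
Let Z_gt0 : 0 < Z.
Proof.
have Z0 : 0 <= Z by have [+ _ _] := slack_weight_total wV yphi; apply.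
rewrite lt_neqAle Z0 andbT; apply/eqP => Z0E.
have := hX measurableT; rewrite setTI lebesgue_ballT -Z0E mul0e.
rewrite /distribution /pushforward preimage_setT probability_setT => /eqP.
by rewrite onee_eq0.
Qed.

Let law_X (A : set (n.+1.-tuple R)) : measurable A ->
  (P (X @^-1` A) * Z%:E = J (\1_A))%E.
Proof.
move=> mA; have := hX mA; rewrite lebesgue_ball// lebesgue_ballT /distribution /pushforward => ->.
by rewrite -muleA inver gt_eqF// -EFinM mulVf ?mule1// gt_eqF.
Qed.

Let integral_X (g : n.+1.-tuple R -> R) : (forall t, 0 <= g t) -> measurable_fun setT g ->
  (Z%:E * \int[P]_w (g (X w))%:E = J g)%E.
Proof.
move=> g0 mg.
have [m mE Im] := @measure_image _ _ T (n.+1.-tuple R) R P X (@measurable_funPT _ _ _ _ X).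
rewrite -Im//.
pose w (t : n.+1.-tuple R) := Z^-1 * eweight V (1%:E - consumption phi t)%E.
have Zi : 0 <= Z^-1 by rewrite invr_ge0 ltW.
have e0 t : 0 <= eweight V (1%:E - consumption phi t)%E by exact: eweight_ge0.
have me : measurable_fun setT (fun t => eweight V (1%:E - consumption phi t)%E) by exact: measurable_weight.
have w0 t : 0 <= w t by rewrite mulr_ge0.
have mw : measurable_fun setT w by apply: measurable_funM.
rewrite (@integral_density _ _ R (@lebesgue_tuple R n.+1) m w w0 mw)//; last first.
  move=> A mA; under eq_integral do rewrite mulrCA.
  rewrite ge0_integralZ//.
  - rewrite -[X in (_ * X)%E]/(J (\1_A)) -law_X// muleCA -EFinM mulVf ?mule1 ?gt_eqF//.
  - by move=> t; rewrite mulr_ge0.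
  - by apply: measurable_funM => //; exact: measurable_indic.
rewrite -ge0_integralZ//.
- apply: eq_integral => t _; rewrite /w; congr (_%:E).
  by field; rewrite gt_eqF.
- exact: ltW.
- by move=> t; rewrite mulr_ge0.
- exact: measurable_funM.
Qed.

Let mY i : measurable_fun setT (Y i : T' -> R). Proof. exact: measurable_funPT. Qed.

Let product_rule_Y : product_rule Q (fun i => Y i : T' -> R).
Proof.
move=> A mA; have := hYindep [set: 'I_n.+1]%SET mA.
rewrite (_ : \bigcap_(i in _) _ = [set w | forall i, A i (Y i w)]).
  by move=> ->; apply: eq_bigl => i; rewrite inE.
by apply/seteqP; split => w /= H i; [apply: H; rewrite /= inE|move=> _; exact: H].
Qed.

Let law_Y i (A : set R) : measurable A -> Q (Y i @^-1` A) = P (X @^-1` [set t | A (tnth t i)]).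
Proof. by move=> mA; exact: (hYX i mA). Qed.

Let marginals_Y : has_marginals Q V phi 1 (fun i => Y i : T' -> R).
Proof.
move=> i A mA; rewrite law_Y//.
rewrite law_X; last first.
  by rewrite -[X in measurable X]setTI; exact: measurable_tnth.
by congr (weighted_integral _ _ _ _); apply/funext => t; exact: eq_indic.
Qed.

(* [Phi] may be unbounded; truncating the coordinates at a bound [B] of the ball
   makes it bounded and changes neither side. *)
Lemma orlicz_comparison (Phi : ('I_n.+1 -> R) -> R) :
  (forall p q, Phi p + Phi q <=
    Phi (fun i => Num.min (p i) (q i)) + Phi (fun i => Num.max (p i) (q i))) ->
  (forall d0 (T0 : measurableType d0) (S : 'I_n.+1 -> T0 -> R),
    (forall i, measurable_fun setT (S i)) ->
    measurable_fun setT (fun w => Phi (fun i => S i w))) ->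
  (forall L, exists M, forall p, (forall i, `|p i| <= L) -> `|Phi p| <= M) ->
  (\int[P]_w (Phi (fun i => `|a i * rv_coord X i w|))%:E <=
   \int[Q]_w (Phi (fun i => `|a i * Y i w|))%:E)%E.
Proof.
move=> sPhi mPhi bPhi.
have [B B0 HB] := orlicz_ball_bounded yphi.
pose clip i (x : R) : R := `|a i| * Num.min `|x| B.
have [M HM] := bPhi (\sum_i `|a i| * B).
have clipL i (x : R) : `|clip i x| <= \sum_i `|a i| * B.
  apply: (@le_trans _ _ (`|a i| * B)).
    rewrite /clip normrM normr_id; apply: ler_wpM2l => //.
    by rewrite ger0_norm ?ge_min ?lexx ?orbT// le_min normr_ge0.
  by rewrite (bigD1 i)//= lerDl; apply: sumr_ge0 => j _; rewrite mulr_ge0.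
(* Adding [M] makes the truncated functional nonnegative, as the comparison requires; [trunc]
   subtracts it again on both sides. *)
pose g (t : n.+1.-tuple R) := Phi (fun i => clip i (tnth t i)) + M.
have gC t : 0 <= g t <= M + M.
  by have := HM (fun i => clip i (tnth t i)) (fun i => clipL _ _); rewrite ler_norml /g => /andP[? ?]; lra.
have mclip i : measurable_fun setT (clip i).
  apply: measurable_funM => //; apply: measurable_minr => //; exact: measurable_cst.
have mg : measurable_fun setT g.
  apply: measurable_funD => //; apply: mPhi => i.
  by apply: (measurableT_comp (mclip i)); exact: measurable_tnth.
(* [clip i] is a nondecreasing function of [|x|], so it commutes with minima and maxima and
   transfers supermodularity from [Phi] to [g]. *)
have mono i : {homo (fun y => `|a i| * Num.min y B) : x y / x <= y}.
  move=> x y xy; apply: ler_wpM2l => //.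
  by rewrite le_min !ge_min xy lexx orbT.
have sg : abs_supermodular g.
  move=> p q lo hi loE hiE; rewrite /g.
  have := sPhi (fun i => clip i (tnth p i)) (fun i => clip i (tnth q i)).
  rewrite (_ : (fun i => Num.min _ _) = (fun i => clip i (tnth lo i))); last first.
    by apply/funext => i; rewrite /clip loE; have [pq|qp] := leP `|tnth p i| `|tnth q i|;
      [rewrite min_l//; exact: mono|rewrite min_r//; apply: mono; exact: ltW].
  rewrite (_ : (fun i => Num.max _ _) = (fun i => clip i (tnth hi i))); last first.
    by apply/funext => i; rewrite /clip hiE; have [pq|qp] := leP `|tnth p i| `|tnth q i|;
      [rewrite max_r//; exact: mono|rewrite max_l//; apply: mono; exact: ltW].
  lra.
have cmp : (\int[P]_w (g (X w))%:E <= \int[Q]_w (g (joint (fun i => Y i : T' -> R) w))%:E)%E.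
  have := @supermodular_comparison R _ T' Q n.+1 V phi g (M + M) 1 _ wV (@log_concave_unit_step R)
    yphi gC mg sg mY product_rule_Y Z_gt0 marginals_Y.
  rewrite -integral_X//; last by move=> t; case/andP: (gC t).
  by rewrite lee_pmul2l ?lte_fin.
have clipE i (x : R) : `|x| <= B -> clip i x = `|a i * x|.
  by move=> xB; rewrite /clip min_l// normrM.
have mX i : measurable_fun setT (fun w => tnth (X w) i).
  exact: (measurableT_comp (measurable_tnth i)).
have Ptrunc i : P [set w | B < `|tnth (X w) i|] = 0%E.
  have mA : measurable [set t : n.+1.-tuple R | B < `|tnth t i|].
    have := @measurable_tnth _ R n.+1 i measurableT _ (measurable_set_norm_gt B).
    by rewrite setTI.
  have := law_X mA; rewrite (_ : J _ = 0%E).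
    by move/eqP; rewrite mule_eq0 eqe (gt_eqF Z_gt0) orbF => /eqP.
  rewrite -lebesgue_ball// (_ : _ `&` _ = set0) ?measure0//.
  by apply/seteqP; split => // t [/= Bt /HB/(_ i)]; rewrite leNgt Bt.
(* Being bounded by [B] almost surely concerns one coordinate at a time, so it passes from [X] to
   [Y] through the marginals. *)
have Qtrunc i : Q [set w | B < `|Y i w|] = 0%E.
  rewrite -(Ptrunc i); exact: (law_Y i (measurable_set_norm_gt B)).
have trunc d0 (T0 : measurableType d0) (P0 : probability T0 R) (S : 'I_n.+1 -> T0 -> R) :
    (forall i, measurable_fun setT (S i)) -> (forall i, P0 [set w | B < `|S i w|] = 0%E) ->
    (\int[P0]_w (Phi (fun i => `|a i * S i w|))%:E =
     \int[P0]_w (Phi (fun i => clip i (S i w)) + M)%:E - M%:E)%E.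
  move=> mS S0.
  have mPc : measurable_fun setT (fun w => Phi (fun i => clip i (S i w))).
    by apply: mPhi => i; exact: (measurableT_comp (mclip i)).
  rewrite -(@expectation_subr_cst _ _ _ _ _ (M + M)); last 2 first.
  - exact: measurable_funD.
  - move=> w; have := HM (fun i => clip i (S i w)) (fun i => clipL _ _).
    by rewrite ler_norml => /andP[? ?]; lra.
  apply: ae_eq_integral => //.
  - apply/measurable_EFinP; apply: mPhi => i.
    by apply: measurableT_comp => //; exact: measurable_funM.
  - by apply/measurable_EFinP; apply: measurable_funB => //; exact: measurable_funD.
  exists (\big[setU/set0]_(i < n.+1) [set w | B < `|S i w|]).
  have mSi i : measurable [set w | B < `|S i w|].
    by have := mS i measurableT _ (measurable_set_norm_gt B); rewrite setTI.
  have [mU U0] : measurable (\big[setU/set0]_(i < n.+1) [set w | B < `|S i w|]) /\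
      P0 (\big[setU/set0]_(i < n.+1) [set w | B < `|S i w|]) = 0%E.
    elim/big_ind : _ => [|A1 A2 [mA1 A10] [mA2 A20]|i _]; first by rewrite measure0.
    - by split; [exact: measurableU|rewrite measureU0].
    - by split.
  split => //.
  move=> w /= H; apply: contrapT => nH; apply: H => _.
  congr (_%:E); rewrite addrK; congr Phi; apply/funext => i.
  rewrite clipE// leNgt; apply/negP => Bi; apply: nH.
  by rewrite -bigcup_seq; exists i => //=; rewrite mem_index_enum.
have TX := trunc _ _ P (fun i w => tnth (X w) i) mX Ptrunc.
have TY := trunc _ _ Q (fun i => Y i : T' -> R) mY Qtrunc.
rewrite /rv_coord TX TY; apply: leeB => //; apply: (le_trans cmp).
rewrite le_eqVlt; apply/orP; left; apply/eqP; apply: eq_integral => w _.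
by rewrite /g; congr ((Phi _ + M)%:E); apply/funext => i; rewrite tnth_mktuple.
Qed.

End main.

Theorem theorem1p4 (R : realType) (n : nat)
    (phi : 'I_n.+1 -> R -> \bar R)
    (hphi : forall i, young_function (phi i))
    (a : 'I_n.+1 -> R)
    (d : measure_display) (T : measurableType d) (P : probability T R)
    (X : {RV P >-> n.+1.-tuple R})
    (hX : uniform_on (@lebesgue_tuple R n.+1) (orlicz_ball phi) X)
    (d' : measure_display) (T' : measurableType d') (Q : probability T' R)
    (Y : 'I_n.+1 -> {RV Q >-> R})
    (hYindep : mutually_independent Y)
    (hYX : forall i, same_distribution (Y i) (rv_coord X i : {RV P >-> R}))
    (f : R -> R)
    (hf : convex_function (setT : set (convex_lmodType R^o)) f) :
  ('E_P[fun w => f (\sum_(i < n.+1) `|a i * rv_coord X i w|)%R] <=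
   'E_Q[fun w => f (\sum_(i < n.+1) `|a i * Y i w|)%R])%E /\
  ({homo f : x y / x <= y} ->
   forall c : 'I_n.+1 -> R,
   ('E_P[fun w =>
      f (max_partial_sum (fun i => `|a i * rv_coord X i w| - c i)%R)] <=
    'E_Q[fun w =>
      f (max_partial_sum (fun i => `|a i * Y i w| - c i)%R)])%E).

Proof.
have f_bounded := convex_function_bounded hf.
have f_measurable := convex_function_measurable hf.
split; last first.
  move=> hmono c; rewrite unlock.
  apply: (@orlicz_comparison R n phi hphi a d T P X hX d' T' Q Y hYindep hYX
    (fun p => f (max_partial_sum (fun i => p i - c i)))).
  - move=> p q.
    set pc := fun i => p i - c i; set qc := fun i => q i - c i.
    have -> : (fun i => Num.min (p i) (q i) - c i) = (fun i => Num.min (pc i) (qc i)).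
      by apply/funext => i; rewrite /pc /qc addr_minl.
    have -> : (fun i => Num.max (p i) (q i) - c i) = (fun i => Num.max (pc i) (qc i)).
      by apply/funext => i; rewrite /pc /qc addr_maxl.
    have := max_partial_sum_supermodular pc qc.
    set lo := max_partial_sum (fun i => Num.min _ _).
    set hi := max_partial_sum (fun i => Num.max _ _).
    move=> Mle; set Mp := max_partial_sum pc in Mle *; set Mq := max_partial_sum qc in Mle *.
    have lop : lo <= Mp by apply: max_partial_sum_homo => i; rewrite ge_min lexx.
    have loq : lo <= Mq by apply: max_partial_sum_homo => i; rewrite ge_min lexx orbT.
    (* Convexity handles the four points with equal sums; supermodularity only gives
       [Mp + Mq - lo <= hi], and monotonicity of [f] closes this gap. *)
    apply: (@le_trans _ _ (f lo + f (Mp + Mq - lo))).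
      by apply: convex_function_spread => //; lra.
    by rewrite lerD2l; apply: hmono; lra.
  - move=> d0 T0 S mS; apply: (measurableT_comp f_measurable).
    apply: (measurable_max_partial_sum (X := fun i w => S i w - c i)) => i.
    exact: measurable_funB.
  - move=> L; have [M HM] := f_bounded (n.+1%:R * (L + \sum_i `|c i|)).
    exists M => p pL; apply: HM; apply: max_partial_sum_bounded => i.
    apply: le_trans (ler_normB _ _) _; apply: lerD => //.
    by rewrite (bigD1 i)//= lerDl; apply: sumr_ge0.
rewrite unlock.
apply: (@orlicz_comparison R n phi hphi a d T P X hX d' T' Q Y hYindep hYX
  (fun p => f (\sum_(i < n.+1) p i))).
(* The sum is modular: minima and maxima together preserve the total, so the four sums meet the
   hypothesis of [convex_function_spread] with equality. *)
- move=> p q; apply: convex_function_spread => //.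
  + by apply: ler_sum => i _; rewrite ge_min lexx.
  + by apply: ler_sum => i _; rewrite ge_min lexx orbT.
  + by apply: ler_sum => i _; rewrite le_max lexx.
  + by apply: ler_sum => i _; rewrite le_max lexx orbT.
  + by rewrite -!big_split /=; apply: eq_bigr => i _; rewrite addr_min_max.
- move=> d0 T0 S mS; apply: (measurableT_comp f_measurable).
  by apply: measurable_sum.
- move=> L; have [M HM] := f_bounded (n.+1%:R * L).
  exists M => p pL; apply: HM; apply: le_trans (ler_norm_sum _ _ _) _.
  apply: le_trans (ler_sum _ (fun i _ => pL i)) _.
  by rewrite sumr_const card_ord mulr_natl.
Qed.
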